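(* Let $E=\mathbb{N}=\{0,1,2,\dots\}$, let $\pi$ be a probability distribution on $\mathbb{N}$, let $\gamma(x,dy)=\frac12(\delta_{x-1}(dy)+\delta_{x+1}(dy))$, and let $g$ be a non-decreasing, continuous balancing function. Assume that there exist $\tilde a,a>0$, $\beta>1$ and $k>0$ such that $g(s)\ge s^{\tilde a}$ for all $s\ge1$, $\pi(n)>0$ for all $n\in\mathbb{N}$, and for all $n\ge k$ $$\frac{\pi(n)}{\pi(n+1)}\ge\exp\{a\beta n^{\beta-1}\}.$$ Then the locally-balanced Markov jump process with balancing function $g$, base kernel $\gamma$ and target distribution $\pi$ is uniformly ergodic.
   Context: A balancing function is a function $g:[0,\infty)\to[0,\infty)$ with $g(1)=1$, $g(0)=0$, $g(s)>0$ for $s>0$, and $g(s)=s\,g(1/s)$ for all $s>0$. In this setting the locally-balanced Markov jump process (LBMJP) $(Y_t)_{t\ge0}$ is the continuous-time Markov jump process on $\mathbb{N}$ with jump kernel $J(x,dy)=g(t(x,y))\gamma(x,dy)$, where $t(x,y)=\pi(y)/\pi(x)$; i.e. from state $n$ it jumps to $n+1$ at rate $\frac12g\left(\frac{\pi(n+1)}{\pi(n)}\right)$ and to $n-1$ at rate $\frac12g\left(\frac{\pi(n-1)}{\pi(n)}\right)$, with the convention $\pi(-1)=0$ (so, as $g(0)=0$, no jump leaves $\mathbb{N}$). Uniform ergodicity: there exist $K>0$ and $\rho<1$ such that for all $x\in\mathrm{supp}(\pi)$ and all $t\ge0$, $\|\mathbb{P}_x(Y_t\in\cdot)-\pi(\cdot)\|_{TV}\le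 K\rho^t$, where $\mathbb{P}_x$ is the law of the process started from $x$ and $\|\cdot\|_{TV}$ denotes total variation distance. *)

(* Defs.v *)
From HB Require Import structures.
From mathcomp Require Import all_boot all_order all_algebra.
From mathcomp Require Import all_classical all_reals all_analysis.

Set Implicit Arguments.
Unset Strict Implicit.
Unset Printing Implicit Defensive.

Import Order.TTheory GRing.Theory Num.Theory.
Import numFieldNormedType.Exports.

Local Open Scope classical_set_scope.
Local Open Scope ring_scope.

(* A function [0, oo) -> [0, oo) is represented by a function R -> R whose
   values at negative arguments are irrelevant; nonnegativity on [0, oo)
   follows from g 0 = 0 and positivity on (0, oo). *)
Definition balancing_function (R : realType) (g : R -> R) : Prop :=
  [/\ g 1 = 1, g 0 = 0,
      forall s, 0 < s -> 0 < g s &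
      forall s, 0 < s -> g s = s * g s^-1].

Definition mass (R : realType) (pi : probability nat R) (n : nat) : R :=
  fine (pi [set n]).

(* Restriction to nat of (delta_(x-1) + delta_(x+1)) / 2.  For x = 0 the atom
   at -1 is dropped: its jump rate is g(0) / 2 = 0.  (With x.-1 it would
   wrongly become an atom at 0.) *)
Definition nn_kernel (R : realType) (x y : nat) : R :=
  2^-1 * ((y.+1 == x)%:R + (y == x.+1)%:R).

Definition lb_rate (R : realType) (g : R -> R) (gamma : nat -> nat -> R)
    (pi : probability nat R) (x y : nat) : R :=
  g (mass pi y / mass pi x) * gamma x y.

Definition exit_rate (R : realType) (J : nat -> nat -> R) (i : nat) : R :=
  limn (series (J i)).

Definition jump_prob (R : realType) (J : nat -> nat -> R) (i j : nat) : R :=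
  J i j / exit_rate J i.

(* Under P, Y is a Markov jump process on nat with jump rates J started from x,
   for J without absorbing states (0 < exit_rate J i < oo for all i).
   Z is the chain of visited states and H the sequence of holding times; the
   first clause says that Z is a Markov chain with transition probabilities
   jump_prob J, Z 0 = x, and that, given Z, the H k are independent and
   exponential with rates exit_rate J (Z k).
   Non-explosion is not assumed: Y is left arbitrary after an explosion. Only
   the values Y t for 0 <= t matter. *)
Definition markov_jump_process (R : realType) (J : nat -> nat -> R) (x : nat)
    (d : measure_display) (T : measurableType d) (P : probability T R)
    (Y : R -> {mfun T >-> nat}) : Prop :=
  exists (Z : nat -> {mfun T >-> nat}) (H : nat -> {mfun T >-> R}),
    (forall (n : nat) (i : nat -> nat) (B : nat -> set R),
       (forall k, measurable (B k)) ->
       P (\bigcap_(k in `I_n.+1)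
            ((Z k @^-1` [set i k]) `&` (H k @^-1` B k))) =
       (((i 0%N == x)%:R * \prod_(k < n) jump_prob J (i k) (i k.+1))%:E *
        \prod_(k < n.+1) exponential_prob (exit_rate J (i k)) (B k))%E) /\
    {ae P, forall w, forall (n : nat) (t : R),
       \sum_(k < n) H k w <= t < \sum_(k < n.+1) H k w -> Y t w = Z n w}.

Definition tv_dist (R : realType) (d : measure_display) (T : measurableType d)
    (mu nu : probability T R) : \bar R :=
  ereal_sup [set `|mu A - nu A|%E | A in [set A : set T | measurable A]].

(* P x is the law under which Y starts from x.  0 < rho is required because
   rho `^ t is 1 by convention when rho is negative. *)
Definition uniformly_ergodic (R : realType) (d : measure_display)
    (T : measurableType d) (P : nat -> probability T R)
    (Y : R -> {mfun T >-> nat}) (pi : probability nat R) : Prop :=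
  exists K rho : R, [/\ 0 < K, 0 < rho, rho < 1 &
    forall (x : nat) (t : R), 0 < mass pi x -> 0 <= t ->
      (tv_dist (distribution (P x) (Y t)) pi <= (K * rho `^ t)%:E)%E].

(* Main.v *)
Require Import Defs.
From HB Require Import structures.
From mathcomp Require Import all_boot all_order all_algebra.
From mathcomp Require Import all_classical all_reals all_analysis.
From mathcomp Require Import measurable_realfun.
From mathcomp Require Import ring lra zify.

(** The process is a birth-death chain on the natural numbers; write b and d for
    its birth and death rates.  The identity g s = s * g s^-1 makes it
    reversible with respect to pi.  The tail hypothesis makes pi n / pi n.+1
    large, so that b is at most 1 from some point on, while
    d n.+1 >= exp (atilde * a * beta * n `^ (beta - 1)) / 2 outgrows every
    polynomial.  Hence the chain comes down from infinity: started anywhere, it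
    runs straight down to 0 within one unit of time with a probability bounded
    below by some delta > 0, because both the chances of an upward move and
    suitable time budgets for the successive steps are summable
    ([jump_exp_minor], [descent_weight_bounded]).  This is a Doeblin condition
    that is uniform in the starting point.  It makes the oscillation of
    x |-> P_x (Y_t \in A) shrink by the factor 1 - delta per unit of time
    ([transition_contraction]), and pi A lies between the infimum and the
    supremum of this function because pi is stationary ([stationary_le]).

    Everything is reduced to statements on the quantities
      jump_exp n f x t = E_x [f (Y_t); exactly n jumps before time t],
    which are defined by recursion on n, decomposing at the first jump.  As
    functions of t they solve linear equations K' = G - q * K, so that
    identities and inequalities between them follow from uniqueness and
    comparison for these equations ([ode_unique], [ode_ge0]).  In this way one
    obtains the semigroup property ([jump_exp_semigroup]), reversibility
    ([jump_trans_reversible]), the lower bound along the straight descent, and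
    non-explosion ([defect_bounds]).

    The definition of a Markov jump process only describes the law of visited
    states and holding times on product sets.  For a fixed path of states the
    holding times are therefore independent exponential variables, and
    [sojourn_law] computes the probability that exactly n of them have elapsed
    at time t.  Summing over the admissible paths bounds P_x (Y_t \in A) from
    below by the sum of the jump_exp n; applying this to A and to its
    complement, whose bounds add up to 1 by non-explosion, turns the
    inequality into an equality ([law_transition]). *)

Set Implicit Arguments.
Unset Strict Implicit.
Unset Printing Implicit Defensive.

Import Order.TTheory GRing.Theory Num.Theory.
Import numFieldNormedType.Exports.

Local Open Scope classical_set_scope.
Local Open Scope ring_scope.

(** * Convolution with an exponential, and linear first-order equations *)

(** The second integral makes this an antiderivative on the whole line, so that
    no one-sided derivatives occur at 0; for 0 < t it is an integral over the
    empty set.  Locking keeps unification from unfolding the integrals. *)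
HB.lock Definition primitive (R : realType) (G : R -> R) (t : R) : R :=
  (\int[@lebesgue_measure R]_(s in `[0, t]) G s) -
  (\int[@lebesgue_measure R]_(s in `[t, 0]) G s).

(** For 0 <= t this is the convolution \int_0^t exp (- q * s) * G (t - s) ds. *)
HB.lock Definition expconv (R : realType) (q : R) (G : R -> R) (t : R) : R :=
  expR (- q * t) * primitive (fun s => expR (q * s) * G s) t.

Section Expconv.
Context {R : realType}.
Implicit Types (G K : R -> R) (q t : R).
Local Notation mu := (@lebesgue_measure R).

Lemma continuous_integrable_itv G a c : continuous G ->
  mu.-integrable `[a, c] (EFin \o G).
Proof.
move=> cG; apply: continuous_compact_integrable; first exact: segment_compact.
exact: continuous_subspaceT.
Qed.

Lemma primitiveE G a t : continuous G -> a <= 0 -> a <= t ->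
  primitive G t = (\int[mu]_(s in `[a, t]) G s) - (\int[mu]_(s in `[a, 0]) G s).
Proof.
move=> cG a0 at_.
have I b c : mu.-integrable `[b, c] (EFin \o G) by exact: continuous_integrable_itv.
have Io b c : mu.-integrable `]b, c] (EFin \o G).
  by apply: integrableS (I b c) => //; exact: subset_itv_oc_cc.
rewrite primitive.unlock; case: (leP 0 t) => [t0|t0].
  rewrite (@Rintegral_itvB _ G (BLeft a) (BRight t) 0)// ?bnd_simp//.
  rewrite Rintegral_itv_obnd_cbnd//.
  suff -> : \int[mu]_(s in `[t, 0]) G s = 0 by rewrite subr0.
  move: t0; rewrite le_eqVlt => /predU1P[<-|t0].
    by rewrite set_itv1 Rintegral_set1.
  by rewrite set_itv_ge ?Rintegral_set0// bnd_simp -ltNge.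
rewrite [X in X - _](_ : _ = 0); last first.
  by rewrite set_itv_ge ?Rintegral_set0// bnd_simp -ltNge.
rewrite -(@Rintegral_itv_obnd_cbnd _ t)// sub0r.
by rewrite -(@Rintegral_itvB _ G (BLeft a) (BRight 0) t)// ?bnd_simp ?opprB// ltW.
Qed.

Lemma primitive0 G : primitive G 0 = 0.
Proof. by rewrite primitive.unlock subrr. Qed.

Lemma is_derive_primitive G t : continuous G -> is_derive t 1 (primitive G) (G t).
Proof.
move=> cG; pose a := - `|t| - 1.
have a0 : a < 0 by rewrite /a; have := normr_ge0 t; lra.
have at_ : a < t by rewrite /a; have := ler_norm (- t); rewrite normrN; lra.
have [dF F'] := @continuous_FTC1_closed R G a t (t + 1) (ltr_pwDr ltr01 (lexx t))
  (continuous_integrable_itv _ _ cG) at_ (cG t).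
have dF' : is_derive t 1 (fun x => \int[mu]_(s in `[a, x]) G s) (G t).
  by apply: DeriveDef; [exact: dF|rewrite -derive1E; exact: F'].
have dH : is_derive t 1 (fun x => (\int[mu]_(s in `[a, x]) G s) -
    (\int[mu]_(s in `[a, 0]) G s)) (G t).
  by apply: is_derive_eq; rewrite subr0.
apply: (near_eq_is_derive _ dH) => //; rewrite ?oner_eq0//.
near=> s; rewrite (@primitiveE G a)//; first exact: ltW.
by apply: ltW; near: s; exact: lt_nbhsr.
Unshelve. all: by end_near. Qed.

Lemma derive_continuous (f df : R -> R) :
  (forall t, is_derive t 1 f (df t)) -> continuous f.
Proof.
move=> h t; apply: differentiable_continuous; apply/derivable1_diffP.
by have [] := h t.
Qed.

Lemma is_derive_expRM q (t : R) :
  is_derive t 1 (fun r : R => expR (q * r)) (q * expR (q * t)).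
Proof.
have : is_derive t 1 (fun r : R => q * r) q.
  by apply: is_derive_eq; rewrite /GRing.scale/= mulr1.
by move=> ?; apply: is_derive_eq; rewrite /GRing.scale/= mulrC.
Qed.

Lemma is_derive_expR_mul q (D D' : R -> R) :
    (forall t : R, is_derive t 1 D (D' t)) -> forall t : R,
  is_derive t 1 (fun r => expR (q * r) * D r) (expR (q * t) * (D' t + q * D t)).
Proof.
move=> dD t; have e1 := is_derive_expRM q t.
by apply: is_derive_eq; rewrite /GRing.scale/=; ring.
Qed.

Lemma continuous_lincomb (a c : R) G K : continuous G -> continuous K ->
  continuous (fun t => a * G t + c * K t).
Proof.
move=> cG cK t; apply: cvgD.
  by apply: cvgM; [exact: cvg_cst|exact: cG].
by apply: cvgM; [exact: cvg_cst|exact: cK].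
Qed.

(** Comparison principle: the function expR (q * r) * D r is non-decreasing. *)
Lemma ode_ge0 q (D D' : R -> R) (s t : R) :
  (forall r : R, is_derive r 1 D (D' r)) ->
  s <= t -> 0 <= D s -> (forall r, s < r < t -> 0 <= D' r + q * D r) ->
  0 <= D t.
Proof.
move=> dD st Ds h.
pose E r := expR (q * r) * D r.
have dE := is_derive_expR_mul q dD; rewrite -/E in dE.
have : E s <= E t.
  apply: (@ger0_derive1_le_cc R E s t); rewrite ?in_itv/= ?lexx ?st//.
  - move=> r; rewrite in_itv/= => rst; rewrite derive1E derive_val.
    by rewrite mulr_ge0 ?expR_ge0// h.
  - exact/continuous_subspaceT/(derive_continuous dE).
rewrite /E => h1; have h2 : 0 <= expR (q * t) * D t.
  by apply: le_trans h1; rewrite mulr_ge0// expR_ge0.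
by rewrite -(@pmulr_rge0 _ (expR (q * t)))// expR_gt0.
Qed.

(** For the difference D of two solutions, expR (q * r) * D r is constant. *)
Lemma ode_unique q (K L M : R -> R) :
  (forall t : R, is_derive t 1 K (M t - q * K t)) ->
  (forall t : R, is_derive t 1 L (M t - q * L t)) ->
  K 0 = L 0 -> K = L.
Proof.
move=> dK dL KL0.
have dD (t : R) : is_derive t 1 (fun t => K t - L t) (- (q * (K t - L t))).
  by apply: is_derive_eq; rewrite mulrBr; ring.
apply/funext => t; apply/eqP; rewrite -subr_eq0.
have dE (r : R) : is_derive r 1 (fun r => expR (q * r) * (K r - L r)) 0.
  by have := is_derive_expR_mul q dD r; rewrite addNr mulr0.
have /eqP := @is_derive_0_is_cst R _ t 0 dE.
by rewrite KL0 subrr mulr0 mulf_eq0 gt_eqF ?expR_gt0.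
Qed.

Lemma expconv0 q G : expconv q G 0 = 0.
Proof. by rewrite expconv.unlock primitive0 mulr0. Qed.

Lemma is_derive_expconv q G (t : R) : continuous G ->
  is_derive t 1 (expconv q G) (G t - q * expconv q G t).
Proof.
move=> cG.
have cF : continuous (fun s => expR (q * s) * G s).
  move=> s; apply: cvgM; last exact: cG.
  by apply: (derive_continuous (is_derive_expRM q)).
have dP r := @is_derive_primitive _ r cF.
have := is_derive_expR_mul (- q) dP t.
rewrite mulrDr mulrA -expRD -mulrDl addNr mul0r expR0 mul1r expconv.unlock.
by rewrite mulrCA mulNr.
Qed.

Lemma continuous_expconv q G : continuous G -> continuous (expconv q G).
Proof.
by move=> cG; apply: derive_continuous => t; exact: is_derive_expconv.
Qed.

Lemma expconv_unique q G K : continuous G -> K 0 = 0 ->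
  (forall t : R, is_derive t 1 K (G t - q * K t)) -> K = expconv q G.
Proof.
move=> cG K0 dK; apply: (ode_unique dK); last by rewrite expconv0.
by move=> t; exact: is_derive_expconv.
Qed.

Lemma expconv_linear q (a c : R) G K : continuous G -> continuous K ->
  expconv q (fun t => a * G t + c * K t) =
  (fun t => a * expconv q G t + c * expconv q K t).
Proof.
move=> cG cK; apply: esym; apply: expconv_unique.
- exact: continuous_lincomb.
- by rewrite !expconv0 !mulr0 addr0.
move=> t; have dG := is_derive_expconv q t cG; have dK := is_derive_expconv q t cK.
by apply: is_derive_eq; rewrite /GRing.scale/=; ring.
Qed.

Lemma expconvZ q (c : R) G : continuous G ->
  expconv q (fun t => c * G t) = (fun t => c * expconv q G t).
Proof.
move=> cG; have := expconv_linear q c 0 cG cG.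
rewrite (_ : (fun t => _) = (fun t => c * G t)); last first.
  by apply/funext => t; rewrite mul0r addr0.
by move=> ->; apply/funext => t; rewrite mul0r addr0.
Qed.

(** For p != q, partial fractions: (q - p) times either side is the difference
    expconv p G - expconv q G. *)
Lemma expconvC p q G : continuous G ->
  expconv p (expconv q G) = expconv q (expconv p G).
Proof.
move=> cG; have [->//|pq] := eqVneq p q.
have cp := @continuous_expconv p G cG; have cq := @continuous_expconv q G cG.
have H a c : continuous (expconv c G) -> expconv a (fun t => (c - a) * expconv c G t) =
    (fun t => expconv a G t - expconv c G t).
  move=> cc; apply: esym; apply: expconv_unique.
  - by move=> t; apply: cvgM; [exact: cvg_cst|exact: cc].
  - by rewrite !expconv0 subrr.
  move=> t; have da := is_derive_expconv a t cG.
  have dc := is_derive_expconv c t cG.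
  by apply: (is_derive_eq (is_deriveB da dc)); ring.
have scal a c : continuous (expconv c G) ->
    expconv a (fun t => (c - a) * expconv c G t) =
    (fun t => (c - a) * expconv a (expconv c G) t) by exact: expconvZ.
apply/funext => t.
have := congr1 (@^~ t) (etrans (esym (scal p q cq)) (H p q cq)).
have := congr1 (@^~ t) (etrans (esym (scal q p cp)) (H q p cp)).
move=> /= h1 h2; apply/eqP; rewrite -subr_eq0.
have : (q - p) * (expconv p (expconv q G) t - expconv q (expconv p G) t) = 0.
  rewrite mulrBl in h1; rewrite mulrBl in h2; rewrite mulrBl !mulrBr; lra.
move=> /eqP; rewrite mulf_eq0 => /orP[|->//].
by move=> h; rewrite subr_eq0 eq_sym (negbTE pq) in h.
Qed.

(** The case of [expconvC] where G is a Dirac mass at 0. *)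
Lemma expconv_expRC p q :
  expconv p (fun t => expR (- q * t)) = expconv q (fun t => expR (- p * t)).
Proof.
have [->//|pq] := eqVneq p q.
have ce a : continuous (fun t => expR (- a * t)).
  exact: (derive_continuous (is_derive_expRM (- a))).
have H a c : c - a != 0 -> expconv a (fun t => expR (- c * t)) =
    (fun t => (c - a)^-1 * (expR (- a * t) - expR (- c * t))).
  move=> ca; apply: esym; apply: expconv_unique.
  - exact: ce.
  - by rewrite !mulr0 subrr mulr0.
  move=> t; have da := is_derive_expRM (- a) t.
  have dc := is_derive_expRM (- c) t.
  by apply: is_derive_eq; rewrite /GRing.scale/=; field.
rewrite !H ?subr_eq0//; last by rewrite eq_sym.
have -> : (p - q)^-1 = - (q - p)^-1 by rewrite -invrN opprB.
by apply/funext => t; ring.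
Qed.

Lemma expconv_ge0 q G t : continuous G ->
  (forall s, 0 <= s -> 0 <= G s) -> 0 <= t -> 0 <= expconv q G t.
Proof.
move=> cG G0 t0; apply: (@ode_ge0 q _ (fun t => G t - q * expconv q G t) 0) => //.
- by move=> r; exact: is_derive_expconv.
- by rewrite expconv0.
- by move=> r /andP[r0 _]; rewrite subrK G0// ltW.
Qed.

End Expconv.

(** * Birth-death chains decomposed by their number of jumps *)

Section BirthDeath.
Context {R : realType}.
Variables (b d : nat -> R).
Implicit Types (f h : nat -> R) (x y n : nat).
Local Notation q x := (b x + d x).

(** E_x [f (Y_t); exactly n jumps before t] for the chain with birth rates b and
    death rates d, decomposed at the first jump: the chain waits an exponential
    time of rate b x + d x, then moves up or down.  The value x.-1 = 0 at x = 0
    is harmless since d 0 = 0 where it matters. *)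
Fixpoint jump_exp n f x : R -> R :=
  match n with
  | 0 => fun t => f x * expR (- q x * t)
  | m.+1 => expconv (q x)
      (fun t => b x * jump_exp m f x.+1 t + d x * jump_exp m f x.-1 t)
  end.

Arguments jump_exp : simpl never.

Lemma jump_exp0E f x : jump_exp 0 f x = fun t => f x * expR (- q x * t).
Proof. by []. Qed.

Lemma jump_expSE n f x : jump_exp n.+1 f x = expconv (q x)
  (fun t => b x * jump_exp n f x.+1 t + d x * jump_exp n f x.-1 t).
Proof. by []. Qed.

Let jump_expE := (jump_exp0E, jump_expSE).

Lemma is_derive_jump_exp0 f x (t : R) :
  is_derive t 1 (jump_exp 0 f x) (- (q x * jump_exp 0 f x t)).
Proof.
have e := is_derive_expRM (- q x) t.
by rewrite jump_exp0E; apply: is_derive_eq; rewrite /GRing.scale/=; ring.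
Qed.

Lemma continuous_jump_exp n f x : continuous (jump_exp n f x).
Proof.
elim: n x => [|n ih] x.
  by apply: derive_continuous => t; exact: is_derive_jump_exp0.
by rewrite jump_expSE; apply: continuous_expconv; apply: continuous_lincomb.
Qed.

Lemma is_derive_jump_expS n f x (t : R) :
  is_derive t 1 (jump_exp n.+1 f x)
    (b x * jump_exp n f x.+1 t + d x * jump_exp n f x.-1 t
     - q x * jump_exp n.+1 f x t).
Proof.
apply: is_derive_expconv; apply: continuous_lincomb; exact: continuous_jump_exp.
Qed.

Lemma jump_exp_init n f x : jump_exp n f x 0 = if n is 0 then f x else 0.
Proof.
by case: n => [|n]; rewrite jump_expE ?expconv0// mulr0 expR0 mulr1.
Qed.

Lemma jump_exp_ge0 n f x t : (forall x, 0 <= b x) -> (forall x, 0 <= d x) ->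
  (forall y, 0 <= f y) -> 0 <= t -> 0 <= jump_exp n f x t.
Proof.
move=> b0 d0 f0; elim: n x t => [|n ih] x t t0; rewrite jump_expE.
  by rewrite mulr_ge0 ?f0 ?expR_ge0.
apply: expconv_ge0 => //.
  by apply: continuous_lincomb; exact: continuous_jump_exp.
by move=> s s0; rewrite addr_ge0 ?mulr_ge0 ?ih.
Qed.

Lemma jump_exp_linear n f h (a c : R) x t :
  jump_exp n (fun y => a * f y + c * h y) x t =
  a * jump_exp n f x t + c * jump_exp n h x t.
Proof.
elim: n x t => [|n ih] x t; first by rewrite !jump_exp0E; ring.
rewrite jump_expSE.
pose G k t := b x * jump_exp n k x.+1 t + d x * jump_exp n k x.-1 t.
rewrite (_ : (fun t => _) = fun t => a * G f t + c * G h t); last first.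
  by apply/funext => s; rewrite !ih /G; ring.
by rewrite expconv_linear//; apply: continuous_lincomb; exact: continuous_jump_exp.
Qed.

Lemma jump_expB n f h x t :
  jump_exp n (fun y => f y - h y) x t = jump_exp n f x t - jump_exp n h x t.
Proof.
have := jump_exp_linear n f h 1 (-1) x t.
rewrite mul1r mulN1r => <-; congr jump_exp.
by apply/funext => y; rewrite mul1r mulN1r.
Qed.

Lemma jump_expZ n f (c : R) x t :
  jump_exp n (fun y => c * f y) x t = c * jump_exp n f x t.
Proof.
have := jump_exp_linear n f f c 0 x t.
rewrite mul0r addr0 => <-; congr jump_exp.
by apply/funext => y; rewrite mul0r addr0.
Qed.

Lemma jump_expD n f h x t :
  jump_exp n (fun y => f y + h y) x t = jump_exp n f x t + jump_exp n h x t.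
Proof.
have := jump_exp_linear n f h 1 1 x t.
rewrite !mul1r => <-; congr jump_exp.
by apply/funext => y; rewrite !mul1r.
Qed.

(** Chapman-Kolmogorov, sorted by the number k of jumps before time s.  Both
    sides solve the same equation in s with the same value at s = 0. *)
Lemma jump_exp_semigroup n f x s t :
  jump_exp n f x (s + t) =
  \sum_(k < n.+1) jump_exp k (fun y => jump_exp (n - k) f y t) x s.
Proof.
elim: n x s => [|n ih] x s.
  by rewrite big_ord1 !jump_exp0E mulrDr expRD mulrA mulrAC.
pose h k y := jump_exp (n - k) f y t.
rewrite big_ord_recl subn0.
under eq_bigr do rewrite lift0 subSS.
pose L r := jump_exp n.+1 f x (r + t).
pose Rh r := jump_exp 0 (jump_exp n.+1 f ^~ t) x r +
  \sum_(k < n.+1) jump_exp k.+1 (h k) x r.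
pose M r := b x * jump_exp n f x.+1 (r + t) + d x * jump_exp n f x.-1 (r + t).
suff LR : L = Rh by exact: (congr1 (@^~ s) LR).
apply: (@ode_unique _ (q x) _ _ M).
- move=> r.
  have dr : is_derive r 1 (fun r : R => r + t) 1 by apply: is_derive_eq; rewrite addr0.
  have dL := is_derive_jump_expS n f x (r + t).
  have := @is_derive1_comp _ (jump_exp n.+1 f x) (fun r => r + t) r _ _ dL dr.
  by rewrite mulr1.
- move=> r.
  have d0 := is_derive_jump_exp0 (jump_exp n.+1 f ^~ t) x r.
  have ds := @is_derive_sum _ _ _ n.+1 (fun k => jump_exp k.+1 (h k) x) r 1 _
    (fun k => is_derive_jump_expS k (h k) x r).
  have := is_deriveD d0 ds.
  rewrite (_ : _ + _ = Rh); last first.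
    by apply/funext => z; rewrite /Rh fctE fct_sumE.
  move=> dR; apply: (is_derive_eq dR).
  rewrite /M !ih !mulr_sumr /Rh sumrB big_split/= -!mulr_sumr /h; ring.
rewrite /L /Rh add0r jump_exp_init big1 ?addr0// => k _.
by rewrite jump_exp_init.
Qed.

(** E_x [f (Y_t); fewer than N jumps before t]. *)
Definition partial_exp N f x t := \sum_(n < N) jump_exp n f x t.

Lemma partial_expS N f x t : partial_exp N.+1 f x t =
  jump_exp 0 f x t + \sum_(n < N) jump_exp n.+1 f x t.
Proof. by rewrite /partial_exp big_ord_recl. Qed.

Lemma is_derive_partial_exp N f x (t : R) :
  is_derive t 1 (partial_exp N.+1 f x)
    (b x * partial_exp N f x.+1 t + d x * partial_exp N f x.-1 t
     - q x * partial_exp N.+1 f x t).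
Proof.
have d0 := is_derive_jump_exp0 f x t.
have ds := @is_derive_sum _ _ _ N (fun k => jump_exp k.+1 f x) t 1 _
  (fun k => is_derive_jump_expS k f x t).
have := is_deriveD d0 ds.
rewrite (_ : _ + _ = partial_exp N.+1 f x); last first.
  by apply/funext => z; rewrite partial_expS fctE fct_sumE.
move=> dR; apply: (is_derive_eq dR).
rewrite partial_expS /partial_exp sumrB big_split/= -!mulr_sumr; ring.
Qed.

Lemma partial_exp_init N f x : partial_exp N.+1 f x 0 = f x.
Proof.
by rewrite partial_expS big1 ?addr0 ?jump_exp_init// => k _; rewrite jump_exp_init.
Qed.

Section Nonexplosion.
Variable lam : R.
Hypotheses (b0 : forall x, 0 <= b x) (d0 : forall x, 0 <= d x) (d00 : d 0 = 0)
  (blam : forall x, 3 * b x <= lam).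

Let defect N x t := 1 - partial_exp N (fun=> 1) x t.

Let is_derive_defect N x (t : R) : is_derive t 1 (defect N.+1 x)
  (b x * defect N x.+1 t + d x * defect N x.-1 t - q x * defect N.+1 x t).
Proof.
have dP := is_derive_partial_exp N (fun=> 1) x t.
by apply: is_derive_eq; rewrite /defect; ring.
Qed.

(** Non-explosion, quantitatively: the middle term is the probability of at
    least N jumps before t.  The upper bound is a supersolution of the first-jump
    equation: passing from (x, N.+1) to (x.+1, N) multiplies it by 4, passing to
    (x.-1, N) leaves it unchanged, and the excess 3 * b x is absorbed by the
    growth rate lam. *)
Lemma defect_bounds N x t : 0 <= t ->
  0 <= 1 - partial_exp N (fun=> 1) x t <= 2 ^+ x * expR (lam * t) / 2 ^+ N.
Proof.
elim: N x t => [|N ih] x t t0.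
  rewrite /partial_exp big_ord0 subr0 ler01 divr1/=.
  have lam0 : 0 <= lam by apply: le_trans (blam 0); rewrite mulr_ge0// ler0n.
  rewrite -[leLHS]mulr1 ler_pM//; first by rewrite exprn_ege1// ler1n.
  by rewrite -expR0 ler_expR mulr_ge0.
rewrite -/(defect _ _ _); apply/andP; split.
  apply: (@ode_ge0 _ (q x) _ _ 0 t (is_derive_defect N x)) => //.
    by rewrite /defect partial_exp_init subrr.
  move=> r /andP[r0 _]; rewrite subrK addr_ge0// mulr_ge0//.
    by have /andP[] := ih x.+1 r (ltW r0).
  by have /andP[] := ih x.-1 r (ltW r0).
rewrite ler_pdivlMr ?exprn_gt0 ?ltr0n// -subr_ge0.
pose W t := 2 ^+ x * expR (lam * t) - defect N.+1 x t * 2 ^+ N.+1.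
pose W' t := 2 ^+ x * (lam * expR (lam * t)) -
  (b x * defect N x.+1 t + d x * defect N x.-1 t - q x * defect N.+1 x t) * 2 ^+ N.+1.
have dW (r : R) : is_derive r 1 W (W' r).
  have dd := is_derive_defect N x r; have de := is_derive_expRM lam r.
  apply: is_derive_eq; rewrite /W' /GRing.scale/=; ring.
apply: (@ode_ge0 _ (q x) W W' 0 t) => //.
  rewrite /W /defect partial_exp_init subrr mul0r subr0 mulr_ge0 ?expR_ge0//.
move=> r /andP[/ltW r0 _].
have -> : W' r + q x * W r = 2 ^+ x * expR (lam * r) * (lam + q x) -
    2 * (b x * (defect N x.+1 r * 2 ^+ N) + d x * (defect N x.-1 r * 2 ^+ N)).
  by rewrite /W' /W exprS; ring.
rewrite subr_ge0.
have N2 : 0 < 2 ^+ N :> R by rewrite exprn_gt0// ltr0n.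
have h1 : b x * (defect N x.+1 r * 2 ^+ N) <= b x * (2 ^+ x.+1 * expR (lam * r)).
  by rewrite ler_wpM2l// -ler_pdivlMr//; have /andP[] := ih x.+1 r r0.
have h2 : d x * (2 * (defect N x.-1 r * 2 ^+ N)) <= d x * (2 ^+ x * expR (lam * r)).
  case: x {W W' dW h1} => [|x]; first by rewrite d00 !mul0r.
  rewrite ler_wpM2l// exprS -mulrA ler_wpM2l ?ler0n// -ler_pdivlMr//.
  by have /andP[] := ih x r r0.
have h3 : 0 <= 2 ^+ x * expR (lam * r) * (lam - 3 * b x).
  by rewrite !mulr_ge0 ?exprn_ge0 ?expR_ge0 ?ler0n// subr_ge0.
rewrite exprS in h1; move: h1 h2 h3.
move: (defect N _ _ * _) (defect N _ _ * _) (expR _) (2 ^+ x) => A B C E.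
lra.
Qed.

End Nonexplosion.

Section Reversibility.

Lemma eq_jump_exp n f h x t : (forall y, (y <= x + n)%N -> f y = h y) ->
  jump_exp n f x t = jump_exp n h x t.
Proof.
elim: n x t => [|n ih] x t fh; rewrite !jump_expE; first by rewrite fh ?addn0.
congr (expconv _ _ t); apply/funext => s; congr (_ * _ + _ * _); apply: ih => y yx.
  by apply: fh; rewrite addnS.
apply: fh; rewrite addnS; apply: (leq_trans yx).
by rewrite (leq_trans _ (leqnSn _))// leq_add2r leq_pred.
Qed.

(** P_x (Y_t = y; exactly n jumps before t). *)
Definition jump_trans n x y t := jump_exp n (fun z => (z == y)%:R) x t.

Lemma jump_exp_sum_trans n f x M t : (x + n < M)%N ->
  jump_exp n f x t = \sum_(y < M) f y * jump_trans n x y t.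
Proof.
move=> xM; transitivity (jump_exp n (fun z => \sum_(y < M) f y * (z == y)%:R) x t).
  apply: eq_jump_exp => y yx; have yM := leq_ltn_trans yx xM.
  rewrite (bigD1 (Ordinal yM))//= eqxx mulr1 big1 ?addr0// => i iy.
  by rewrite [y == i]eq_sym -[y]/(val (Ordinal yM)) val_eqE (negbTE iy) mulr0.
elim: M {xM} => [|M ih].
  rewrite big_ord0 (_ : (fun z => _) = (fun z => 0 * f z)); last first.
    by apply/funext => z; rewrite big_ord0 mul0r.
  by rewrite jump_expZ mul0r.
rewrite big_ord_recr/= -ih -jump_expZ -jump_expD; congr jump_exp.
by apply/funext => z; rewrite big_ord_recr.
Qed.

Hypothesis d00 : d 0 = 0.

Let birth_into y := if y is y'.+1 then b y' else 0.

Let continuous_jump_trans n x y : continuous (jump_trans n x y).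
Proof. exact: continuous_jump_exp. Qed.

(** Decomposition at the last jump instead of the first one.  The two agree
    because exponential convolutions commute. *)
Lemma jump_trans_forward n x y : jump_trans n.+1 x y =
  expconv (q y) (fun t => birth_into y * jump_trans n x y.-1 t + d y.+1 * jump_trans n x y.+1 t).
Proof.
elim: n x => [|n ih] x.
  pose c := b x * (x.+1 == y)%:R + d x * (x.-1 == y)%:R.
  have ce z : continuous (fun t => expR (- q z * t)).
    exact: (derive_continuous (is_derive_expRM (- q z))).
  have Z a z : expconv a (fun t => c * expR (- q z * t)) =
      (fun t => c * expconv a (fun t => expR (- q z * t)) t).
    by have := @expconvZ _ a c _ (ce z).
  rewrite /jump_trans !jump_expE.
  transitivity (expconv (q x) (fun t => c * expR (- q y * t))).
    congr expconv; apply/funext => t; rewrite /c mulrDl !mulrA; congr (_ + _).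
      by case: eqP => [->//|_]; rewrite mulr0 !mul0r.
    by case: eqP => [->//|_]; rewrite mulr0 !mul0r.
  rewrite Z expconv_expRC -Z; congr expconv.
  apply/funext => t; rewrite !mulrA -mulrDl; congr (_ * _).
  rewrite /c /birth_into; case: y {c Z} => [|y].
    by case: x => [|[|x]]; rewrite /= ?d00 ?mulr0 ?mul0r ?addr0.
  rewrite eqSS/=; congr (_ + _); first by case: eqP => [->//|_]; rewrite !mulr0.
  case: x => [|x]; first by rewrite d00 mul0r/= mulr0.
  by rewrite eqSS/=; case: eqP => [->//|_]; rewrite !mulr0.
pose I m z t := birth_into y * jump_trans m z y.-1 t + d y.+1 * jump_trans m z y.+1 t.
have cI m z : continuous (I m z) by apply: continuous_lincomb.
have -> : jump_trans n.+2 x y = expconv (q x)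
    (fun t => b x * jump_trans n.+1 x.+1 y t + d x * jump_trans n.+1 x.-1 y t) by [].
rewrite !ih -!/(I _ _) -expconv_linear// expconvC; last exact: continuous_lincomb.
congr expconv.
pose B z t := b x * jump_trans n x.+1 z t + d x * jump_trans n x.-1 z t.
have cB z : continuous (B z) by exact: continuous_lincomb.
transitivity (expconv (q x) (fun t => birth_into y * B y.-1 t + d y.+1 * B y.+1 t)).
  by congr expconv; apply/funext => t; rewrite /I /B; ring.
by rewrite (@expconv_linear _ _ _ _ (B y.-1) (B y.+1)).
Qed.

(** Detailed balance passes to paths with n jumps: the last-jump decomposition
    started at y is the first-jump decomposition started at x, read backwards. *)
Lemma jump_trans_reversible (w : nat -> R) n x y t :
  (forall z, w z * b z = w z.+1 * d z.+1) ->
  w x * jump_trans n x y t = w y * jump_trans n y x t.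
Proof.
move=> wbd; elim: n x y t => [|n ih] x y t.
  rewrite /jump_trans !jump_expE; case: (eqVneq x y) => [->//|xy].
  by rewrite !mul0r !mulr0.
pose G1 t := b x * jump_trans n x.+1 y t + d x * jump_trans n x.-1 y t.
pose G2 t := birth_into x * jump_trans n y x.-1 t + d x.+1 * jump_trans n y x.+1 t.
have cG1 : continuous G1 by exact: continuous_lincomb.
have cG2 : continuous G2 by exact: continuous_lincomb.
have -> : jump_trans n.+1 x y = expconv (q x) G1 by [].
have -> : jump_trans n.+1 y x = expconv (q x) G2 by rewrite jump_trans_forward.
transitivity (expconv (q x) (fun s => w x * G1 s) t); first by rewrite expconvZ.
transitivity (expconv (q x) (fun s => w y * G2 s) t); last by rewrite expconvZ.
congr (expconv _ _ t); apply/funext => s; rewrite /G1 /G2 !mulrDr.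
rewrite [RHS]addrC; congr (_ + _).
  by rewrite mulrA wbd mulrAC ih; ring.
clear cG1 cG2; clear G1 G2; case: x => [|x]; first by rewrite d00 /=; ring.
by rewrite /= mulrA -wbd mulrAC ih; ring.
Qed.

End Reversibility.

Section Minorization.
Hypotheses (b0 : forall x, 0 <= b x) (d0 : forall x, 0 <= d x)
  (dS : forall x, 0 < d x.+1).

(** Lower bound for the probability of running straight down from x to 0 and
    staying there, within one unit of time.  The step leaving y.+1 is given
    the time 1 / y.+1 - 1 / y.+2; these times sum up to less than 1, and the
    factor is the probability that the step is a death that occurs in time. *)
Fixpoint descent_weight x : R :=
  if x is y.+1 then
    descent_weight y * (d y.+1 / q y.+1 *
      (1 - expR (- q y.+1 * ((y.+1%:R)^-1 - (y.+2%:R)^-1))))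
  else expR (- q 0).

Let invS_le y : (y.+2%:R)^-1 <= (y.+1%:R)^-1 :> R.
Proof. by rewrite lef_pV2 ?posrE ?ltr0n// ler_nat. Qed.

Let qS y : 0 < q y.+1. Proof. by rewrite ltr_wpDl. Qed.

Lemma descent_weight_ge0 x : 0 <= descent_weight x.
Proof.
elim: x => [|x ih] /=; first exact: expR_ge0.
rewrite mulr_ge0// mulr_ge0//; first by rewrite divr_ge0// ltW.
by rewrite subr_ge0 expR_le1 mulNr oppr_le0 mulr_ge0 ?subr_ge0 ?invS_le ?(ltW (qS _)).
Qed.

(** The time budget for the descent from x is 1 - 1 / x.+1.  Keeping the bound on
    the whole interval up to time 1 is what makes the induction work: after the
    step from x.+1 to x the remaining time is not known exactly. *)
Lemma jump_exp_minor x h t : (forall y, 0 <= h y) ->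
  1 - (x.+1%:R)^-1 <= t <= 1 -> descent_weight x * h 0 <= jump_exp x h x t.
Proof.
move=> h0; elim: x t => [|x ih] t.
  rewrite invr1 subrr => /andP[t0 t1]; rewrite jump_exp0E /= mulrC ler_wpM2l// ler_expR.
  by rewrite mulNr lerN2 ler_piMr// addr_ge0.
pose T : R := 1 - (x.+1%:R)^-1.
have T0 : 0 <= T by rewrite subr_ge0 invf_le1// ler1n.
have TT : T <= 1 - x.+2%:R^-1 by rewrite lerB.
move=> /andP[T2t t1]; have Tt := le_trans TT T2t.
pose qq := q x.+1; have qq0 : 0 < qq by exact: qS.
pose c := descent_weight x * h 0 * (d x.+1 / qq).
have c0 : 0 <= c by rewrite !mulr_ge0 ?descent_weight_ge0 ?invr_ge0// ltW.
apply: (@le_trans _ _ (c * (1 - expR (- qq * (t - T))))).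
  have -> : descent_weight x.+1 * h 0 =
      c * (1 - expR (- qq * (x.+1%:R^-1 - x.+2%:R^-1))) by rewrite /= /c -/qq; ring.
  rewrite ler_wpM2l// lerB// ler_expR !mulNr lerN2 ler_wpM2l ?(ltW qq0)//.
  by move: T2t; rewrite /T; move: (x.+1%:R^-1) (x.+2%:R^-1) => A C; lra.
rewrite -subr_ge0.
pose D r := jump_exp x.+1 h x.+1 r - c * (1 - expR (- qq * (r - T))).
pose D' r := (b x.+1 * jump_exp x h x.+2 r + d x.+1 * jump_exp x h x r
     - qq * jump_exp x.+1 h x.+1 r) - c * (qq * expR (- qq * (r - T))).
have dD (r : R) : is_derive r 1 D (D' r).
  have d1 := is_derive_jump_expS x h x.+1 r.
  have dr : is_derive r 1 (fun r : R => r - T) 1.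
    by apply: is_derive_eq; rewrite subr0.
  have d2 := @is_derive1_comp _ (fun z => expR (- qq * z)) (fun r => r - T) r _ _
    (is_derive_expRM (- qq) (r - T)) dr.
  have d3 : is_derive r 1 (fun r => c * (1 - expR (- qq * (r - T))))
      (c * (qq * expR (- qq * (r - T)))).
    apply: (is_derive_eq (is_deriveZ c (is_deriveB (is_derive_cst (1:R) r 1) d2))).
    by rewrite /GRing.scale/=; ring.
  exact: (is_deriveB d1 d3).
apply: (@ode_ge0 _ qq D D' T t) => //.
- rewrite /D subrr mulr0 expR0 subrr mulr0 subr0.
  exact: jump_exp_ge0.
- move=> r /andP[Tr rt].
  have -> : D' r + qq * D r = b x.+1 * jump_exp x h x.+2 r +
      d x.+1 * (jump_exp x h x r - descent_weight x * h 0).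
    by rewrite /D' /D /c; field; rewrite gt_eqF.
  rewrite addr_ge0// mulr_ge0//.
    by rewrite jump_exp_ge0// ltW// (le_lt_trans T0).
  by rewrite subr_ge0 ih// (ltW Tr)/= (le_trans (ltW rt)).
Qed.

Let expRN_le_inv (z : R) : 0 < z -> expR (- z) <= z^-1.
Proof.
move=> z0; rewrite expRN lef_pV2 ?posrE ?expR_gt0//.
by apply: le_trans (expR_ge1Dx z); rewrite lerDr.
Qed.

Lemma descent_weight_gt0 x : 0 < descent_weight x.
Proof.
elim: x => [|x ih] /=; first exact: expR_gt0.
rewrite mulr_gt0// mulr_gt0//; first by rewrite divr_gt0.
rewrite subr_gt0 expR_lt1 mulNr oppr_lt0 mulr_gt0// subr_gt0.
by rewrite ltf_pV2 ?posrE ?ltr0n// ltr_nat.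
Qed.

(** The step is an upward move with probability b / (b + d), and is late
    with probability exp (- z) <= 1 / z, where z is the exit rate times the time
    budget; the growth of d makes both small. *)
Lemma descent_weightS y : b y.+1 <= 1 -> (y.+2%:R) ^+ 4 <= d y.+1 ->
  descent_weight y * (1 - (y.+2%:R ^+ 2)^-1) <= descent_weight y.+1.
Proof.
move=> b1 d4 /=; rewrite ler_wpM2l ?descent_weight_ge0//.
have q0 := qS y; set D := d y.+1 in q0 d4 *; set B := b y.+1 in b1 q0 *.
have D0 : 0 < D by exact: dS.
have B0 : 0 <= B by exact: b0.
set s : R := y.+1%:R; have sE : y.+2%:R = s + 1 by rewrite -natr1.
have s0 : 0 < s by rewrite ltr0n.
have s10 : 0 < s + 1 by rewrite ltr_wpDl ?ltW.
rewrite sE in d4 *.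
have tauE : s^-1 - (s + 1)^-1 = (s * (s + 1))^-1.
  by field; rewrite !gt_eqF.
have h1 : expR (- (B + D) * (s^-1 - (s + 1)^-1)) <= s * (s + 1) / (B + D).
  rewrite tauE mulNr; apply: (le_trans (expRN_le_inv _)).
    by rewrite divr_gt0// mulr_gt0.
  by rewrite invfM invrK mulrC.
have -> : D / (B + D) = 1 - B / (B + D).
  by field; rewrite gt_eqF.
have h2 : (B + s * (s + 1)) / (B + D) <= ((s + 1) ^+ 2)^-1.
  rewrite ler_pdivrMr// [leRHS]mulrC ler_pdivlMr ?exprn_gt0//.
  apply: (@le_trans _ _ ((s + 1) ^+ 4)); last by rewrite (le_trans d4)// lerDr.
  rewrite [leRHS](exprD _ 2 2) ler_wpM2r ?exprn_ge0 ?(ltW s10)//.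
  by rewrite expr2; nra.
have e0 : 0 <= expR (- (B + D) * (s^-1 - (s + 1)^-1)) by exact: expR_ge0.
have r0 : 0 <= B / (B + D) by rewrite divr_ge0// ltW.
rewrite mulrDl in h2; move: e0 r0 h1 h2.
move: (expR _) => E.
move: (B / _) (s * (s + 1) / _) (((s + 1) ^+ 2)^-1) => r z w; nra.
Qed.

(** Beyond m the weights decrease at most like the telescoping product of the
    factors 1 - 1 / y.+2 ^ 2 = (y.+1 / y.+2) * (y.+3 / y.+2). *)
Lemma descent_weight_bounded m :
  (forall y, (m <= y)%N -> b y <= 1 /\ (y.+1%:R) ^+ 4 <= d y) ->
  exists2 delta, 0 < delta & forall x, delta <= descent_weight x.
Proof.
move=> hm.
have decr y : descent_weight y.+1 <= descent_weight y.
  rewrite /= ler_piMr ?descent_weight_ge0// mulr_ile1//.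
  - by rewrite divr_ge0// ltW.
  - by rewrite subr_ge0 expR_le1 mulNr oppr_le0 mulr_ge0 ?subr_ge0 ?invS_le ?(ltW (qS _)).
  - by rewrite ler_pdivrMr// mul1r lerDr.
have decr_le k : (k <= m)%N -> descent_weight m <= descent_weight k.
  move=> km; rewrite -(subnK km); elim: (m - k)%N => // j ih.
  by rewrite addSn (le_trans (decr _)).
have m0 := descent_weight_gt0 m.
have grow k : descent_weight m / 2 * ((m + k).+2%:R / (m + k).+1%:R)
    <= descent_weight (m + k).
  elim: k => [|k ih].
    rewrite addn0 -[leRHS]mulr1 -mulrA ler_wpM2l ?(ltW m0)//.
    rewrite mulrC ler_pdivrMr ?ltr0n// mul1r ler_pdivrMr ?ltr0n//.
    by rewrite -natrM ler_nat; lia.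
  have [b1 d4] := hm (m + k).+1 (leq_trans (leq_addr k m) (leqnSn _)).
  rewrite addnS; apply: le_trans (descent_weightS b1 d4).
  set y := (m + k)%N in ih *.
  have s0 : 0 < y.+1%:R :> R by rewrite ltr0n.
  have -> : y.+3%:R = y.+1%:R + 2 :> R by rewrite -!natr1; ring.
  have -> : y.+2%:R = y.+1%:R + 1 :> R by rewrite -!natr1; ring.
  move: ih; have -> : y.+2%:R = y.+1%:R + 1 :> R by rewrite -!natr1; ring.
  move: y.+1%:R s0 => s s0 ih.
  have s1 : 0 < s + 1 by rewrite ltr_wpDl ?ltW.
  have f0 : 0 <= 1 - ((s + 1) ^+ 2)^-1.
    rewrite subr_ge0 invf_le1 ?exprn_gt0// exprn_ege1// lerDr; exact: ltW.
  apply: le_trans (ler_wpM2r f0 ih).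
  rewrite le_eqVlt; apply/orP; left; apply/eqP; field.
  by rewrite !gt_eqF.
exists (descent_weight m / 2); first by rewrite divr_gt0.
move=> x; have [xm|mx] := leqP x m.
  rewrite (le_trans _ (decr_le _ xm))// ler_pdivrMr// ler_peMr ?(ltW m0)//.
  by rewrite ler1n.
rewrite -(subnKC (ltnW mx)); apply: le_trans (grow _).
rewrite ler_peMr ?divr_ge0 ?(ltW m0)// ler_pdivlMr ?ltr0n// mul1r.
by rewrite ler_nat.
Qed.

End Minorization.

End BirthDeath.

(** * Doeblin contraction and stationarity *)

Lemma sum_triangle (V : nmodType) (a : nat -> nat -> V) M :
  \sum_(m < M) \sum_(k < m.+1) a k (m - k)%N = \sum_(k < M) \sum_(n < M - k) a k n.
Proof.
elim: M => [|M ih]; first by rewrite !big_ord0.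
rewrite big_ord_recr/= ih.
transitivity (\sum_(k < M.+1) (\sum_(n < M - k) a k n + a k (M - k)%N)).
  rewrite big_split/=; congr (_ + _).
  by rewrite [RHS]big_ord_recr/= subnn big_ord0 addr0.
by apply: eq_bigr => k _; rewrite (subSn (leq_ord k)) big_ord_recr.
Qed.

Lemma cvgn_to_le (R : realType) (u : nat -> R) (l M : R) n0 :
  u n @[n --> \oo] --> l -> (forall n, (n0 <= n)%N -> u n <= M) -> l <= M.
Proof. by move=> ul uM; apply: (cvgr_to_le ul); exists n0. Qed.

Section Contraction.
Context {R : realType}.
Variables (b d : nat -> R) (lam : R).
Hypotheses (b0 : forall x, 0 <= b x) (d0 : forall x, 0 <= d x) (d00 : d 0 = 0)
  (blam : forall x, 3 * b x <= lam).
Implicit Types (f h : nat -> R) (x y n : nat).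
Local Notation partial := (partial_exp b d).

Definition unit_valued f := forall x, 0 <= f x <= 1.

Let unit_compl f : unit_valued f -> unit_valued (fun x => 1 - f x).
Proof. by move=> f01 x; have /andP[? ?] := f01 x; apply/andP; split; lra. Qed.

(** E_x [f (Y_t)], given non-explosion. *)
Definition transition f x t : R := limn (fun N => partial N f x t).

Lemma partial_exp_ge0 N f x t : unit_valued f -> 0 <= t -> 0 <= partial N f x t.
Proof.
move=> f01 t0; apply: sumr_ge0 => n _; apply: jump_exp_ge0 => // y.
by have /andP[] := f01 y.
Qed.

Lemma partial_expC N f x t :
  partial N (fun y => 1 - f y) x t = partial N (fun=> 1) x t - partial N f x t.
Proof. by rewrite /partial_exp -sumrB; apply: eq_bigr => n _; rewrite jump_expB. Qed.

Lemma partial_exp_le1 N f x t : unit_valued f -> 0 <= t -> partial N f x t <= 1.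
Proof.
move=> f01 t0; have := partial_exp_ge0 N x (unit_compl f01) t0.
rewrite partial_expC; have /andP[+ _] := defect_bounds b0 d0 d00 blam N x t0; lra.
Qed.

Lemma nondecreasing_partial_exp f x t : unit_valued f -> 0 <= t ->
  nondecreasing_seq (fun N => partial N f x t).
Proof.
move=> f01 t0; apply/nondecreasing_seqP => N.
rewrite /partial_exp big_ord_recr/= lerDl; apply: jump_exp_ge0 => // y.
by have /andP[] := f01 y.
Qed.

Lemma cvg_partial_exp f x t : unit_valued f -> 0 <= t ->
  partial N f x t @[N --> \oo] --> transition f x t.
Proof.
move=> f01 t0; apply: nondecreasing_is_cvgn; first exact: nondecreasing_partial_exp.
by exists 1 => _ [N _ <-]; exact: partial_exp_le1.
Qed.

Lemma partial_exp_le N f x t : unit_valued f -> 0 <= t ->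
  partial N f x t <= transition f x t.
Proof.
move=> f01 t0; apply: (@nondecreasing_cvgn_le _ (fun N => partial N f x t)).
  exact: nondecreasing_partial_exp.
by apply: cvgP; exact: cvg_partial_exp.
Qed.

Lemma transition_unit f t : unit_valued f -> 0 <= t ->
  unit_valued (fun x => transition f x t).
Proof.
move=> f01 t0 x; apply/andP; split.
  exact: le_trans (partial_exp_ge0 0 x f01 t0) (partial_exp_le _ _ f01 t0).
apply: (@cvgn_to_le _ _ _ _ 0 (@cvg_partial_exp _ x _ f01 t0)) => N _.
exact: partial_exp_le1.
Qed.

(** The total mass is 1: the chain does not explode. *)
Lemma cvg_partial_exp1 x t : 0 <= t ->
  partial N (fun=> 1) x t @[N --> \oo] --> (1 : R).
Proof.
move=> t0.
apply: (@squeeze_cvgr _ _ _ _ (fun N => 1 - 2 ^+ x * expR (lam * t) * 2^-1 ^+ N) (fun=> 1)).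
- apply: nearW => N; have := defect_bounds b0 d0 d00 blam N x t0.
  by rewrite -exprVn => /andP[? ?]; apply/andP; split; lra.
- rewrite -[X in _ --> X]subr0 -[X in _ --> _ - X](mulr0 (2 ^+ x * expR (lam * t))).
  apply: cvgB; first exact: cvg_cst.
  apply: cvgM; first exact: cvg_cst.
  by apply: cvg_expr; rewrite ger0_norm ?invr_ge0// invf_lt1// ltr1n.
- exact: cvg_cst.
Qed.

Lemma transitionC f x t : unit_valued f -> 0 <= t ->
  transition (fun y => 1 - f y) x t = 1 - transition f x t.
Proof.
move=> f01 t0; apply/cvg_lim => //.
under eq_fun do rewrite partial_expC.
by apply: cvgB; [exact: cvg_partial_exp1|exact: cvg_partial_exp].
Qed.

(** With fewer than K jumps only finitely many states can be reached, so pointwise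
    convergence suffices. *)
Lemma cvg_partial_exp_fun K (F : nat -> nat -> R) f x t :
  (forall y, F N y @[N --> \oo] --> f y) ->
  partial K (F N) x t @[N --> \oo] --> partial K f x t.
Proof.
move=> Ff; rewrite /partial_exp.
apply: cvg_big => [|k _]; first exact: add_continuous.
rewrite (jump_exp_sum_trans _ _ _ _ (ltnSn (x + k))).
under eq_fun do rewrite (jump_exp_sum_trans _ _ _ _ (ltnSn (x + k))).
apply: cvg_big => [|y _]; first exact: add_continuous.
by apply: cvgM; [exact: Ff|exact: cvg_cst].
Qed.

Lemma jump_exp_sum k N (F : nat -> nat -> R) x t :
  jump_exp b d k (fun y => \sum_(n < N) F n y) x t =
  \sum_(n < N) jump_exp b d k (F n) x t.
Proof.
elim: N => [|N ih].
  rewrite big_ord0 (_ : (fun z => _) = (fun z => 0 * F 0 z)); last first.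
    by apply/funext => z; rewrite big_ord0 mul0r.
  by rewrite jump_expZ mul0r.
rewrite big_ord_recr/= -ih -jump_expD; congr (jump_exp _ _ _ _ x t).
by apply/funext => z; rewrite big_ord_recr.
Qed.

(** One inequality of the semigroup property; used for f and for 1 - f, it
    bounds the transition function from both sides. *)
Lemma partial_exp_semigroup K f x s t : unit_valued f -> 0 <= s -> 0 <= t ->
  partial K (fun y => transition f y t) x s <= transition f x (s + t).
Proof.
move=> f01 s0 t0.
apply: (@cvgn_to_le _ _ _ _ 0 (@cvg_partial_exp_fun K (fun N y => partial N f y t) _ x s
  (fun y => @cvg_partial_exp _ y _ f01 t0))) => N _.
apply: le_trans (partial_exp_le (K + N) x f01 (addr_ge0 s0 t0)).
pose a k n := jump_exp b d k (fun y => jump_exp b d n f y t) x s.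
have a0 k n : 0 <= a k n.
  apply: jump_exp_ge0 => // y; apply: jump_exp_ge0 => // z.
  by have /andP[] := f01 z.
rewrite {2}/partial_exp; under [leRHS]eq_bigr do rewrite jump_exp_semigroup.
rewrite (sum_triangle a) big_split_ord/= -[leLHS]addr0 lerD//; last first.
  by apply: sumr_ge0 => k _; exact: sumr_ge0.
apply: ler_sum => k _.
have := jump_exp_sum k N (fun n y => jump_exp b d n f y t) x s.
rewrite /partial_exp => ->.
have -> : (K + N - k = N + (K - k))%N by have := ltn_ord k; lia.
by rewrite big_split_ord/= lerDl sumr_ge0.
Qed.

(** Stationarity of w, as an inequality: the mean of f under w is at most the
    supremum of the transition function.  By reversibility the sum over the
    starting points under w becomes a total mass, which tends to 1; all sums
    involved are finite. *)
Lemma stationary_le (w : nat -> R) f (t M : R) :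
  (forall x, 0 <= w x) -> (forall x, w x * b x = w x.+1 * d x.+1) ->
  (forall L, \sum_(x < L) w x <= 1) ->
  unit_valued f -> 0 <= t -> (forall x, transition f x t <= M) ->
  forall L, \sum_(y < L) w y * f y <= M.
Proof.
move=> w0 wbd w1 f01 t0 fM L.
have M0 : 0 <= M.
  by apply: le_trans (fM 0); have /andP[] := transition_unit f01 t0 0.
have f0 y : 0 <= f y by have /andP[] := f01 y.
have tr0 n x y : 0 <= jump_trans b d n x y t.
  by apply: jump_exp_ge0 => // z; rewrite ler0n.
apply: (@cvgn_to_le _ (fun N => \sum_(y < L) w y * f y * partial N (fun=> 1) y t) _ _ 0).
  apply: cvg_big => [|y _]; first exact: add_continuous.
  by rewrite -[X in _ --> X]mulr1; apply: cvgM; [exact: cvg_cst|exact: cvg_partial_exp1].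
move=> N _; pose X := (L + N)%N.
have -> : \sum_(y < L) w y * f y * partial N (fun=> 1) y t =
    \sum_(x < X) w x * \sum_(n < N) \sum_(y < L) f y * jump_trans b d n x y t.
  transitivity (\sum_(y < L) \sum_(x < X) \sum_(n < N) w x * (f y * jump_trans b d n x y t)).
    apply: eq_bigr => y _; rewrite exchange_big/= /partial_exp mulr_sumr.
    apply: eq_bigr => n _; rewrite (@jump_exp_sum_trans _ _ _ _ _ _ X); last first.
      by rewrite /X; have := ltn_ord y; have := ltn_ord n; lia.
    rewrite mulr_sumr; apply: eq_bigr => x _; rewrite mul1r.
    rewrite -mulrA mulrCA (@jump_trans_reversible _ b d d00 w n y x t wbd); ring.
  rewrite exchange_big/=; apply: eq_bigr => x _; rewrite exchange_big/= mulr_sumr.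
  by apply: eq_bigr => n _; rewrite mulr_sumr.
apply: (@le_trans _ _ (\sum_(x < X) w x * M)); last by rewrite -mulr_suml ler_piMl.
apply: ler_sum => x _; rewrite ler_wpM2l//.
apply: le_trans (fM x); apply: le_trans (partial_exp_le N x f01 t0).
apply: ler_sum => n _.
rewrite (@jump_exp_sum_trans _ _ _ _ _ _ (L + (x + n).+1))//; last by rewrite ltn_addl.
by rewrite big_split_ord/= lerDl sumr_ge0// => y _; rewrite mulr_ge0.
Qed.

Variable delta : R.
Hypotheses (delta0 : 0 <= delta) (delta1 : delta <= 1)
  (minor : forall x h, (forall y, 0 <= h y) -> delta * h 0 <= jump_exp b d x h x 1).

(** Doeblin: after the first unit of time the chain is at 0 with probability at
    least delta, and from any other state f still averages to at least m during
    the remaining time s. *)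
Lemma transition_lower f s m : unit_valued f -> 0 <= s -> 0 <= m ->
  (forall x, m <= transition f x s) ->
  forall x, m + delta * (transition f 0 s - m) <= transition f x (1 + s).
Proof.
move=> f01 s0 m0 hm x; pose h y := transition f y s.
pose g y := h y - m.
have g0 y : 0 <= g y by rewrite subr_ge0; exact: hm.
have cm : m * partial N (fun=> 1) x 1 @[N --> \oo] --> m.
  by rewrite -[X in _ --> X]mulr1; apply: cvgM; [exact: cvg_cst|exact: cvg_partial_exp1].
have := @cvgn_to_le _ _ _ (transition f x (1 + s) - delta * g 0) x.+1 cm.
rewrite lerBrDr; apply => N xN.
rewrite lerBrDr; apply: le_trans (partial_exp_semigroup N x f01 ler01 s0).
have -> : partial N h x 1 = m * partial N (fun=> 1) x 1 + partial N g x 1.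
  rewrite /partial_exp mulr_sumr -big_split/=; apply: eq_bigr => n _.
  rewrite -jump_expZ -jump_expD; congr (jump_exp _ _ _ _ x 1).
  by apply/funext => y; rewrite /g mulr1 addrC subrK.
rewrite lerD2l; apply: le_trans (minor x g0) _.
rewrite /partial_exp (bigD1 (Ordinal xN))//= lerDl sumr_ge0// => n _.
exact: jump_exp_ge0.
Qed.

Lemma transition_contraction f n r : unit_valued f -> 0 <= r ->
  exists m M, [/\ 0 <= m, M <= 1, M - m <= (1 - delta) ^+ n &
    forall x, m <= transition f x (n%:R + r) <= M].
Proof.
move=> f01 r0; elim: n => [|n [m [M [m0 M1 Mm hmM]]]].
  by exists 0, 1; split; rewrite ?subr0 ?add0r// => x; exact: transition_unit.
have s0 : 0 <= n%:R + r :> R by rewrite addr_ge0.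
set s := _ + r in s0 hmM.
have sE : n.+1%:R + r = 1 + s by rewrite /s -natr1; ring.
have lo := transition_lower f01 s0 m0 (fun x => proj1 (andP (hmM x))).
have up : forall x, 1 - M <= transition (fun y => 1 - f y) x s.
  by move=> x; rewrite transitionC// lerB//; have /andP[] := hmM x.
have M10 : 0 <= 1 - M by rewrite subr_ge0.
have {}up := transition_lower (unit_compl f01) s0 M10 up.
have /andP[h0m h0M] := hmM 0.
exists (m + delta * (transition f 0 s - m)), (M - delta * (M - transition f 0 s)).
split.
- by rewrite addr_ge0// mulr_ge0// subr_ge0.
- by rewrite (le_trans _ M1)// gerBl mulr_ge0// subr_ge0.
- rewrite exprS [leLHS](_ : _ = (1 - delta) * (M - m)); last by ring.
  by rewrite ler_wpM2l// subr_ge0.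
- move=> x; rewrite sE lo/=; have := up x.
  rewrite !transitionC ?addr_ge0//; lra.
Qed.

End Contraction.

(** * Sums of independent exponential holding times *)

Section Exponential.
Context {R : realType}.
Local Notation RR := (measurableTypeR R).
Local Notation mu := (@lebesgue_measure R).
Variables (q : R) (q0 : 0 < q).

Definition exponential_law : probability RR R :=
  exponential_distribution_exponential_prob__canonical__probability_measure_Probability q0.

Lemma exponential_prob_ge0part (A : set RR) :
  exponential_prob q A = exponential_prob q (A `&` `[0, +oo[%classic).
Proof.
rewrite /exponential_prob [RHS]integral_mkcondr; apply: eq_integral => x _.
rewrite patchE; case: ifPn => // x0; rewrite /exponential_pdf patchE.
by rewrite (negbTE x0).
Qed.

Lemma exponential_prob_tail (t : R) : 0 <= t ->
  exponential_prob q [set s | t < s] = (expR (- q * t))%:E.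
Proof.
move=> t0; have -> : [set s | t < s] = ~` `]-oo, t].
  apply/seteqP; split => s /=; rewrite in_itv/=.
    by move=> ts; apply/negP; rewrite -ltNge.
  by move=> /negP; rewrite -ltNge.
transitivity (exponential_law (~` `]-oo, t]%classic)) => //.
have mt : measurable (`]-oo, t] : set RR) by exact: measurable_itv.
rewrite probability_setC//.
have -> : exponential_law `]-oo, t]%classic = exponential_prob q `[0, t]%classic.
  transitivity (exponential_prob q `]-oo, t]%classic) => //.
  rewrite exponential_prob_ge0part; congr exponential_prob.
  by apply/seteqP; split => s /=; rewrite !in_itv/= andbT;
    [move=> [-> ->]|move=> /andP[-> ->]].
move: t0; rewrite le_eqVlt => /predU1P[<-|t0].
  by rewrite set_itv1 mulr0 expR0 /exponential_prob integral_set1 sube0.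
by rewrite exponential_prob_itv0c// -!EFinD; congr EFin; ring.
Qed.

(** Integration against the exponential law is integration against its density;
    this is Tonelli for the density times the indicator of C. *)
Lemma exponential_productE d2 (T2 : measurableType d2) (m : probability T2 R)
    (C : set (RR * T2)) : measurable C ->
  ((exponential_law \x m) C =
   \int[mu]_(x in `[0%R, +oo[) ((q * expR (- q * x))%:E * m (xsection C x)))%E.
Proof.
move=> mC.
have -> : ((exponential_law \x m) C = (exponential_law \x^ m) C)%E.
  apply: product_measure_unique => //= A B mA mB.
  exact: (product_measure2E exponential_law m).
pose F (z : RR * T2) := ((exponential_pdf q z.1)%:E * (\1_C z)%:E)%E.
have mF : measurable_fun [set: (RR * T2)%type] F.
  apply: emeasurable_funM; last exact/measurable_EFinP/measurable_indic.
  apply/measurable_EFinP.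
  exact: (measurableT_comp (measurable_exponential_pdf q) measurable_fst).
have F0 z : (0 <= F z)%E.
  by rewrite mule_ge0// lee_fin ?exponential_pdf_ge0// ltW.
transitivity (\int[m]_y \int[mu]_x F (x, y))%E.
  apply: eq_integral => y _ /=; rewrite /exponential_prob integral_mkcond.
  apply: eq_integral => x _; rewrite patchE /F/= indicE mem_ysection.
  by case: ifP => _; rewrite ?mule1 ?mule0.
rewrite -(fubini_tonelli F mF F0) [RHS]integral_mkcond.
apply: eq_integral => x _; rewrite patchE.
transitivity ((exponential_pdf q x)%:E * m (xsection C x))%E.
  transitivity (\int[m]_y ((exponential_pdf q x)%:E * (\1_(xsection C x) y)%:E))%E.
    by apply: eq_integral => y _; rewrite /F/= !indicE mem_xsection.
  rewrite ge0_integralZl//.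
  - by rewrite integral_indic ?setIT//; exact: measurable_xsection.
  - exact/measurable_EFinP/measurable_indic/measurable_xsection.
  - by rewrite lee_fin exponential_pdf_ge0// ltW.
rewrite /exponential_pdf patchE; case: ifP => //; by rewrite mul0e.
Qed.

End Exponential.

Section HoldingTimes.
Context {R : realType}.
Local Notation RR := (measurableTypeR R).
Local Notation mu := (@lebesgue_measure R).

(** The convolution of n + 1 exponentials.  Times the product of the first n
    rates, it is the probability that, of independent exponential times with
    rates q, the first n have elapsed at time t but not the next one. *)
Fixpoint sojourn (q : nat -> R) n : R -> R :=
  match n with
  | 0 => fun t => expR (- q 0 * t)
  | m.+1 => expconv (q 0) (sojourn (fun k => q k.+1) m)
  end.

Lemma continuous_sojourn q n : continuous (sojourn q n).
Proof.
elim: n q => [|n ih] q /=; last exact: continuous_expconv.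
exact: (derive_continuous (is_derive_expRM (- q 0))).
Qed.

(** An antiderivative of the integrand is - q * c * exp (- q h) * K (t - h), where
    K solves K' = S - q * K. *)
Lemma integral_expR_conv (q c : R) (S : R -> R) (t : R) : continuous S -> 0 <= t ->
  (\int[mu]_(h in `[0%R, t]) (q * expR (- q * h) * (c * S (t - h)))%:E =
   (q * c * expconv q S t)%:E)%E.
Proof.
move=> cS; rewrite le_eqVlt => /predU1P[<-|t0].
  by rewrite set_itv1 integral_set1 expconv0 mulr0.
pose K := expconv q S.
pose F h := - (q * c * (expR (- q * h) * K (t - h))).
pose f h := q * expR (- q * h) * (c * S (t - h)).
have dF (h : R) : is_derive h 1 F (f h).
  have d1 := is_derive_expRM (- q) h.
  have d2 : is_derive h 1 (fun h : R => t - h) (-1).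
    by apply: is_derive_eq; rewrite add0r mul1r.
  have d3 := @is_derive1_comp _ K (fun h => t - h) h _ _
    (is_derive_expconv q (t - h) cS) d2.
  have d4 := is_deriveM d1 d3.
  have d5 := is_deriveN (is_deriveZ (q * c) d4).
  apply: (is_derive_eq d5); rewrite /f /K /GRing.scale/=; ring.
have cf : continuous f.
  move=> h; apply: cvgM.
    apply: cvgM; first exact: cvg_cst.
    exact: (derive_continuous (is_derive_expRM (- q))).
  apply: cvgM; first exact: cvg_cst.
  apply: (@continuous_comp _ _ _ (fun h => t - h) S); last exact: cS.
  by apply: cvgB; [exact: cvg_cst|exact: cvg_id].
have cF := derive_continuous dF.
rewrite (@continuous_FTC2 _ f F 0 t t0).
- rewrite -EFinB /F /K subrr expconv0 subr0 !mulr0 expR0 mul1r.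
  by congr EFin; ring.
- exact: continuous_subspaceT.
- split.
  + by move=> h _; have [] := dF h.
  + by apply: cvg_at_right_filter; exact: cF.
  + by apply: cvg_at_left_filter; exact: cF.
- by move=> h _; rewrite derive1E derive_val.
Qed.

Definition occupied (t : R) : set (RR * RR) := [set p | p.1 <= t < p.1 + p.2].

Lemma measurable_occupied t : measurable (occupied t).
Proof.
have -> : occupied t = (fst @^-1` [set` `]-oo, t]]) `&`
    ((fun p : RR * RR => p.1 + p.2) @^-1` [set` `]t, +oo[]).
  apply/seteqP; split => -[x y] /=; rewrite !in_itv/= andbT.
    by move=> /andP[].
  by move=> [? ?]; apply/andP.
apply: measurableI.
  rewrite -[X in measurable X]setTI.
  exact: (@measurable_fst _ _ RR RR _ _ (@measurable_itv R _)).
rewrite -[X in measurable X]setTI.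
have mD : measurable_fun setT (fun p : RR * RR => (p.1 + p.2 : R)).
  apply: (@measurable_funD _ (RR * RR)%type R setT fst snd).
    exact: (@measurable_fst _ _ RR RR).
  exact: (@measurable_snd _ _ RR RR).
exact: mD.
Qed.

(** The pair consisting of the sum of the first n holding times and of the next
    holding time has a law that depends on the rates alone.  By induction, the
    first holding time is independent of the pair built from the others: on
    rectangles by applying the induction hypothesis to the restrictions of nu,
    hence everywhere by uniqueness of product measures.  Allowing a finite
    measure nu of total mass c makes room for these restrictions. *)
Lemma sojourn_law (q : nat -> R) (q0 : forall k, 0 < q k) n :
  exists mu : probability (RR * RR)%type R,
  [/\ forall t, 0 <= t ->
        mu (occupied t) = (\prod_(k < n) q k * sojourn q n t)%:E,
      forall t, t < 0 -> mu (occupied t) = 0%E &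
      forall d (T : measurableType d) (nu : {measure set T -> \bar R})
        (H : nat -> T -> RR) (c : {nonneg R}),
        (forall k, measurable_fun setT (H k)) ->
        (forall B : nat -> set RR, (forall k, measurable (B k)) ->
          nu (\bigcap_(k in `I_n.+1) H k @^-1` B k) =
          (c%:num%:E * \prod_(k < n.+1) exponential_prob (q k) (B k))%E) ->
      forall D : set (RR * RR), @measurable _ (RR * RR)%type D ->
      nu ((\bigcap_(k in `I_n) H k @^-1` `[0, +oo[) `&`
          (fun w => (\sum_(k < n) H k w, H n w)) @^-1` D) = (c%:num%:E * mu D)%E].
Proof.
elim: n q q0 => [|n ih] q q0.
  have mf : measurable_fun setT (fun h : RR => (0 : RR, h)).
    by apply: measurable_fun_pair => //; exact: measurable_cst.
  pose X : {mfun RR >-> (RR * RR)%type} :=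
    HB.pack (fun h : RR => (0 : RR, h)) (isMeasurableFun.Build _ _ _ _ _ mf).
  exists (distribution (exponential_law (q0 0%N)) X); split.
  - move=> t t0; rewrite big_ord0 mul1r /= -(exponential_prob_tail (q0 0%N) t0).
    rewrite /distribution/pushforward/=; congr exponential_prob.
    by apply/seteqP; split => h; rewrite /= /occupied/= add0r t0.
  - move=> t t0; rewrite /distribution/pushforward/= (_ : _ @^-1` _ = set0).
      exact: measure0.
    by apply/seteqP; split => // h /=; rewrite /occupied/= leNgt t0.
  - move=> d T nu H c mH hyp D mD.
    have := hyp (fun=> X @^-1` D) (fun _ => measurable_funPTI X mD).
    rewrite big_ord1 => <-; congr (nu _).
    apply/seteqP; split => w /=.
      by move=> [_]; rewrite big_ord0 => h [|k].
    by move=> /(_ 0%N erefl) h; split => //; rewrite big_ord0.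
have [m [mocc mocc0 mlaw]] := ih (fun k => q k.+1) (fun k => q0 k.+1).
pose E := exponential_law (q0 0%N).
have mf : measurable_fun setT
    (fun z : RR * (RR * RR) => (z.1 + z.2.1 : RR, z.2.2)).
  have m2 : measurable_fun setT (fun z : RR * (RR * RR) => z.2).
    exact: measurable_snd.
  apply: measurable_fun_pair; last exact: (measurableT_comp measurable_snd m2).
  apply: (@measurable_funD _ (RR * (RR * RR))%type R setT fst (fun z => z.2.1)).
    exact: (@measurable_fst _ _ RR (RR * RR)%type).
  exact: (measurableT_comp (@measurable_fst _ _ RR RR) m2).
pose X : {mfun (RR * (RR * RR))%type >-> (RR * RR)%type} :=
  HB.pack (fun z : RR * (RR * RR) => (z.1 + z.2.1 : RR, z.2.2))
    (isMeasurableFun.Build _ _ _ _ _ mf).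
have occE t : distribution (E \x m)%E X (occupied t) =
    (\int[mu]_(h in `[0%R, +oo[)
      ((q 0%N * expR (- q 0%N * h))%:E * m (occupied (t - h))))%E.
  rewrite -[LHS]/((E \x m)%E (X @^-1` occupied t)) exponential_productE; last first.
    exact: measurable_funPTI (measurable_occupied t).
  apply: eq_integral => h _; congr (_ * m _)%E.
  apply/seteqP; split => -[u v]; rewrite /xsection /occupied /= inE/=.
    by rewrite lerBrDl addrC => /andP[-> ?]; rewrite ltrBlDl addrA (addrC h).
  by rewrite lerBrDl ltrBlDl addrA.
exists (distribution (E \x m)%E X); split.
- move=> t t0; rewrite [LHS]occE.
  rewrite big_ord_recl /= -(integral_expR_conv _ _ (@continuous_sojourn _ _) t0).
  have -> : `[0, t]%classic = `[0, +oo[%classic `&` `]-oo, t]%classic :> set R.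
    by apply/seteqP; split => s /=; rewrite !in_itv/= andbT;
      [move=> /andP[]|move=> [-> ->]].
  rewrite integral_mkcondr; apply: eq_integral => h; rewrite inE/= in_itv/= andbT => h0.
  rewrite patchE; case: ifPn; rewrite ?inE ?notin_setE/= in_itv/= => ht.
    by rewrite mocc ?subr_ge0// -EFinM.
  by rewrite mocc0 ?mule0// subr_lt0 ltNge; apply/negP.
- move=> t t0; rewrite [LHS]occE; apply: integral0_eq => h; rewrite /= in_itv/= andbT => h0.
  by rewrite mocc0 ?mule0// subr_lt0 (lt_le_trans t0).
- move=> d T nu H c mH hyp D mD.
  pose H' k := H k.+1.
  pose W w : RR * RR := (\sum_(k < n) H' k w, H' n w).
  have mW : measurable_fun setT (W : T -> RR * RR).
    apply: measurable_fun_pair; last exact: mH.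
    exact: (@measurable_sum _ T R setT _ _ (fun k : 'I_n => H k.+1) (fun k => mH k.+1)).
  pose Good := H 0%N @^-1` `[0, +oo[ `&` \bigcap_(k in `I_n) H' k @^-1` `[0, +oo[.
  have m0oo : measurable (`[0, +oo[%classic : set RR) by exact: measurable_itv.
  have mI k (B : set RR) : measurable B -> measurable (H k @^-1` B).
    by move=> mB; rewrite -[X in measurable X]setTI; exact: mH.
  have mGood : measurable Good.
    apply: measurableI; first exact: mI.
    by apply: bigcap_measurableType => k _; exact: mI.
  have mXW : measurable_fun setT (fun w => (H 0%N w, W w)).
    by apply: measurable_fun_pair; [exact: mH|exact: mW].
  pose nuG : {measure set T -> \bar R} := mrestr nu mGood.
  pose push : {measure set (RR * (RR * RR))%type -> \bar R} :=
    measure_function_pushforward__canonical__measure_function_Measure nuG mXW.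
  have pushE A B : measurable A -> measurable B ->
      push (A `*` B) = (mscale c E A * m B)%E.
    move=> mA mB.
    pose A0 := A `&` `[0, +oo[.
    have mA0 : measurable (A0 : set RR) by exact: measurableI.
    have EA0 : E A = E A0 by exact: exponential_prob_ge0part.
    have fA0 : E A0 \is a fin_num by exact: fin_num_measure.
    have c'0 : 0 <= c%:num * fine (E A0) by rewrite mulr_ge0// fine_ge0.
    pose nu' : {measure set T -> \bar R} := mrestr nu (mI 0%N _ mA0).
    have := mlaw _ T nu' H' (NngNum c'0) (fun k => mH k.+1).
    move=> /(_ _ B mB) h; rewrite /mscale/= EA0.
    have -> : (c%:num%:E * E A0 * m B = (c%:num * fine (E A0))%:E * m B)%E.
      by rewrite EFinM fineK.
    rewrite -h; last first.
      move=> B' mB'; pose B'' k := if k is j.+1 then B' j else A0.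
      have := hyp B'' _ => /(_ _)/[!big_ord_recl]/= hB''.
      rewrite EFinM fineK// -muleA -hB''; last by case.
      rewrite /nu' /mrestr/=; congr (nu _); apply/seteqP; split => w /=.
        by move=> [hw h0] [|k]//= kn; exact: hw.
      by move=> hw; split; [move=> k kn; exact: (hw k.+1)|exact: (hw 0%N)].
    rewrite /push /= /pushforward /nuG /nu' /mrestr; congr (nu _).
    apply/seteqP; split => w /=; rewrite /Good/= /A0 /=.
      by move=> [[? ?] [? ?]].
    by move=> [[? ?] [? ?]].
  have mXD : measurable (X @^-1` D) by exact: measurable_funPTI mD.
  have uniq := @product_measure_unique _ _ _ _ R (mscale c E) m push pushE _ mXD.
  transitivity (push (X @^-1` D)).
    rewrite /push /= /pushforward /nuG /mrestr; congr (nu _).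
    apply/seteqP; split => w /=; rewrite /Good/= /W/= big_ord_recl.
      by move=> [hw Dw]; split => //; split; [exact: (hw 0%N)|move=> k kn; exact: (hw k.+1)].
    by move=> [Dw [h0 hw]]; split => // -[|k]//= kn; exact: hw.
  rewrite -uniq.
  transitivity (c%:num%:E * (\int[E]_x (m \o xsection (X @^-1` D)) x))%E => //.
  rewrite -(@ge0_integral_mscale _ _ _ E setT measurableT c)//.
  exact: measurable_fun_xsection.
Qed.

End HoldingTimes.

(** * The law of the jump process at a given time *)

Section Nested.
Context {R : realType}.
Implicit Types (q : nat -> R) (G K : R -> R) (n j : nat).

(** The convolution operators of the first j visited states, applied to a
    function that accounts for the rest of the path. *)
Fixpoint nested q j G : R -> R :=
  if j is m.+1 then expconv (q 0) (nested (fun k => q k.+1) m G) else G.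

Lemma nested_sojourn q n : nested q n (fun t => expR (- q n * t)) = sojourn q n.
Proof. by elim: n q => [|n ih] q //=; rewrite ih. Qed.

Lemma continuous_nested q j G : continuous G -> continuous (nested q j G).
Proof. by move=> cG; elim: j q => [|j ih] q //=; exact: continuous_expconv. Qed.

Lemma nested_linear q j (a c : R) G K : continuous G -> continuous K ->
  nested q j (fun t => a * G t + c * K t) =
  (fun t => a * nested q j G t + c * nested q j K t).
Proof.
move=> cG cK; elim: j q => [|j ih] q //=.
by rewrite ih expconv_linear//; exact: continuous_nested.
Qed.

Lemma nestedZ q j (c : R) G : continuous G ->
  nested q j (fun t => c * G t) = (fun t => c * nested q j G t).
Proof.
move=> cG; elim: j q => [|j ih] q //=.
by rewrite ih expconvZ//; exact: continuous_nested.
Qed.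

Lemma nestedS q j G : nested q j.+1 G = nested q j (expconv (q j) G).
Proof. by elim: j q => [|j ih] q //=; rewrite -ih. Qed.

Lemma eq_nested q q' j G : (forall k, (k < j)%N -> q k = q' k) ->
  nested q j G = nested q' j G.
Proof.
elim: j q q' => [|j ih] q q' qq' //=.
by rewrite qq'// (ih _ (fun k => q' k.+1))// => k kj; exact: qq'.
Qed.

End Nested.

Arguments nested : simpl never.

Section JumpChain.
Context {R : realType} {disp : measure_display} {T : measurableType disp}.
Variables (P : probability T R) (J : nat -> nat -> R) (b d : nat -> R) (x : nat)
  (Z : nat -> {mfun T >-> nat}) (H : nat -> {mfun T >-> R}).
Hypotheses (JS : forall y, J y y.+1 = b y) (JP : forall y, J y.+1 y = d y.+1)
  (d00 : d 0 = 0) (b0 : forall y, 0 <= b y) (d0 : forall y, 0 <= d y)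
  (exitE : forall y, exit_rate J y = b y + d y)
  (exit_gt0 : forall y, 0 < b y + d y).
Hypothesis J0 : forall y z, 0 <= J y z.
Hypothesis chain : forall (n : nat) (i : nat -> nat) (B : nat -> set R),
  (forall k, measurable (B k)) ->
  P (\bigcap_(k in `I_n.+1) ((Z k @^-1` [set i k]) `&` (H k @^-1` B k))) =
  (((i 0%N == x)%:R * \prod_(k < n) jump_prob J (i k) (i k.+1))%:E *
   \prod_(k < n.+1) exponential_prob (exit_rate J (i k)) (B k))%E.
Implicit Types (i : nat -> nat) (n j : nat) (t : R) (A : set nat).

Local Notation q y := (b y + d y).
Local Notation RR := (measurableTypeR R).

Definition follows n i : set T := \bigcap_(k in `I_n.+1) Z k @^-1` [set i k].

(** Asking the elapsed holding times to be nonnegative makes these events disjoint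
    in n everywhere, and not just almost surely. *)
Definition sojourning n t : set T := (\bigcap_(k in `I_n) H k @^-1` `[0, +oo[) `&`
  [set w | \sum_(k < n) H k w <= t < \sum_(k < n.+1) H k w].

Let mZ k A : measurable (Z k @^-1` A).
Proof. exact: measurable_funPTI. Qed.

Let mH k (B : set R) : measurable B -> measurable (H k @^-1` B).
Proof. exact: measurable_funPTI. Qed.

Lemma measurable_follows n i : measurable (follows n i).
Proof. by apply: bigcap_measurableType => k _; exact: mZ. Qed.

Let sojourningE n t : sojourning n t = (\bigcap_(k in `I_n) H k @^-1` `[0, +oo[) `&`
  (fun w => (\sum_(k < n) H k w, H n w)) @^-1` (occupied t).
Proof.
by apply/seteqP; split => w; rewrite /sojourning /occupied/= big_ord_recr.
Qed.

Lemma measurable_sojourning n t : measurable (sojourning n t).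
Proof.
rewrite sojourningE; apply: measurableI.
  by apply: bigcap_measurableType => k _; apply: mH; exact: measurable_itv.
have mS : measurable_fun [set: T] (fun w => (\sum_(k < n) H k w, H n w) : RR * RR).
  apply: measurable_fun_pair.
    exact: (@measurable_sum _ T R setT _ _ (fun k : 'I_n => H k : T -> R)).
  exact: (measurable_funP (H n)).
rewrite -[X in measurable X]setTI; apply: mS => //; exact: measurable_occupied.
Qed.

(** The jump probabilities are the rates J divided by the exit rates, and the
    latter cancel against the rates in the exponential densities. *)
Lemma follows_sojourning n i t : i 0%N = x -> 0 <= t ->
  P (follows n i `&` sojourning n t) =
  (\prod_(k < n) J (i k) (i k.+1) * sojourn (fun k => q (i k)) n t)%:E.
Proof.
move=> ix t0.
have [m [mocc _ mlaw]] := sojourn_law (fun k => exit_gt0 (i k)) n.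
have c0 : 0 <= \prod_(k < n) jump_prob J (i k) (i k.+1).
  by apply: prodr_ge0 => k _; rewrite /jump_prob divr_ge0// exitE addr_ge0.
pose nu : {measure set T -> \bar R} := mrestr P (measurable_follows n i).
have := mlaw _ T nu (fun k => H k : T -> RR) (NngNum c0) (fun k => measurable_funP (H k)).
move=> /(_ _ (occupied t) (measurable_occupied t)).
rewrite -sojourningE setIC -[nu _]/(P (_ `&` _)) => ->.
  rewrite mocc//= -EFinM mulrA -big_split/=; congr ((_ * _)%:E).
  apply: eq_bigr => k _; rewrite /jump_prob exitE divfK// gt_eqF//.
move=> B mB; rewrite /nu /mrestr/=.
have := @chain n i B mB; rewrite ix eqxx mul1r.
under [X in _ -> _ = (_ * X)%E]eq_bigr do rewrite -exitE.
move=> <-; congr (P _); apply/seteqP; split => w /=.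
  by move=> [h1 h2] k kn; split; [exact: h2|exact: h1].
by move=> h; split => k kn; have [] := h k kn.
Qed.

(** Summing [follows_sojourning] over the n-step continuations of the path
    i 0, ..., i j.  Only moves to neighbours are kept in the sum, whence an
    inequality. *)
Lemma follows_lower n j i t A : i 0%N = x -> 0 <= t ->
  ((\prod_(k < j) J (i k) (i k.+1) *
     nested (fun k => q (i k)) j (jump_exp b d n \1_A (i j)) t)%:E <=
   P (follows j i `&` (Z (j + n)%N @^-1` A) `&` sojourning (j + n) t))%E.
Proof.
move=> ix t0; elim: n j i ix => [|n ih] j i ix.
  rewrite addn0 jump_exp0E nestedZ; last exact: (derive_continuous (is_derive_expRM _)).
  rewrite (nested_sojourn (fun k => q (i k))) indicE.
  have [iA|iA] := boolP (i j \in A); last by rewrite mul0r mulr0 measure_ge0.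
  rewrite mul1r -follows_sojourning//; rewrite le_measure ?inE//.
  - by apply: measurableI; [exact: measurable_follows|exact: measurable_sojourning].
  - apply: measurableI; last exact: measurable_sojourning.
    by apply: measurableI; [exact: measurable_follows|exact: mZ].
  move=> w [fw sw]; split => //; split => //.
  by rewrite /preimage/= (fw j)//=; move: iA; rewrite inE.
(* The path i up to its j-th state, continued by z. *)
pose next z k := if (k <= j)%N then i k else z.
have next0 z : next z 0%N = x by [].
have nextj z : next z j = i j by rewrite /next leqnn.
have nextS z : next z j.+1 = z by rewrite /next ltnn.
pose ev z := follows j.+1 (next z) `&` (Z (j.+1 + n)%N @^-1` A) `&`
  sojourning (j.+1 + n) t.
have mev z : measurable (ev z).
  apply: measurableI; last exact: measurable_sojourning.
  by apply: measurableI; [exact: measurable_follows|exact: mZ].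
pose p := \prod_(k < j) J (i k) (i k.+1).
pose N z := nested (fun k => q (i k)) j.+1 (jump_exp b d n \1_A z) t.
have evP z : ((p * J (i j) z * N z)%:E <= P (ev z))%E.
  have := ih j.+1 (next z) (next0 z); rewrite nextS.
  rewrite big_ord_recr/= nextj nextS.
  rewrite (@eq_nested _ _ (fun k => q (i k))); last first.
    by move=> k kj; rewrite /next -ltnS kj.
  rewrite (_ : \prod_(k < j) _ = p)//; apply: eq_bigr => k _.
  by rewrite /next (ltnW (ltn_ord k)) ltn_ord.
have sub z : ev z `<=` follows j i `&` (Z (j + n.+1)%N @^-1` A) `&` sojourning (j + n.+1) t.
  rewrite /ev addSnnS => w [[fw Aw] sw]; split => //; split => // k kj.
  have := fw k (ltnW kj : (k < j.+2)%N); rewrite /next/= -ltnS.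
  by move: kj => /= ->.
have mtot : measurable (follows j i `&` (Z (j + n.+1)%N @^-1` A) `&` sojourning (j + n.+1) t).
  apply: measurableI; last exact: measurable_sojourning.
  by apply: measurableI; [exact: measurable_follows|exact: mZ].
have cj y : continuous (jump_exp b d n \1_A y) by exact: continuous_jump_exp.
have -> : nested (fun k => q (i k)) j (jump_exp b d n.+1 \1_A (i j)) t =
    b (i j) * N (i j).+1 + d (i j) * N (i j).-1.
  by rewrite jump_expSE -(nestedS (fun k => q (i k))) nested_linear.
case ij : (i j) => [|y].
  rewrite d00 mul0r addr0 mulrA; have := evP 1%N; rewrite ij JS => /le_trans; apply.
  by rewrite le_measure ?inE.
have tI : ev y.+2 `&` ev y = set0.
  apply/seteqP; split => // w [[[h1 _] _] [[h2 _] _]].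
  have := h1 j.+1 (leqnn _); have := h2 j.+1 (leqnn _).
  by rewrite /= !nextS => ->; lia.
apply: (@le_trans _ _ (P (ev y.+2 `|` ev y))).
  rewrite measureU// mulrDr EFinD leeD//.
    by have := evP y.+2; rewrite ij JS mulrA.
  by have := evP y; rewrite ij JP mulrA.
rewrite le_measure ?inE//; first exact: measurableU.
by move=> w [] /sub.
Qed.

Lemma trivIset_sojourning t : trivIset setT (fun n => sojourning n t).
Proof.
apply: ltn_trivIset => m n nm; apply/seteqP; split => // w [[_ /andP[_ tn]] [Hm /andP[mt _]]].
have : \sum_(k < n.+1) H k w <= \sum_(k < m) H k w.
  rewrite -(subnKC nm) big_split_ord/= lerDl sumr_ge0// => k _.
  have /= := Hm (n.+1 + k)%N; rewrite in_itv/= andbT; apply.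
  by have := ltn_ord k; lia.
by move=> /(lt_le_trans tn) /lt_le_trans /(_ mt); rewrite ltxx.
Qed.

Variable Y : R -> {mfun T >-> nat}.
Hypothesis Y_jumps : {ae P, forall w, forall (n : nat) (t : R),
  \sum_(k < n) H k w <= t < \sum_(k < n.+1) H k w -> Y t w = Z n w}.

Lemma partial_exp_le_law N A t : 0 <= t ->
  ((partial_exp b d N \1_A x t)%:E <= P (Y t @^-1` A))%E.
Proof.
move=> t0; pose F n := (Z n @^-1` A) `&` sojourning n t.
have mF n : measurable (F n).
  by apply: measurableI; [exact: mZ|exact: measurable_sojourning].
have FP n : ((jump_exp b d n \1_A x t)%:E <= P (F n))%E.
  have := @follows_lower n 0 (fun=> x) t A erefl t0.
  rewrite big_ord0 mul1r add0n => /le_trans; apply.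
  rewrite le_measure ?inE//.
    apply: measurableI; last exact: measurable_sojourning.
    by apply: measurableI; [exact: measurable_follows|exact: mZ].
  by move=> w [[_ ?] ?]; split.
have tF : trivIset setT F.
  by apply: trivIset_setIl; exact: trivIset_sojourning.
have [N0 [mN0 PN0 YN0]] := Y_jumps.
apply: (@le_trans _ _ (P (\big[setU/set0]_(n < N) F n))).
  rewrite measure_bigsetU// /partial_exp -sumEFin.
  by apply: lee_sum => n _; exact: FP.
have mY : measurable (Y t @^-1` A) by exact: measurable_funPTI.
have mU : measurable (\big[setU/set0]_(n < N) F n) by exact: bigsetU_measurable.
apply: (@le_trans _ _ (P ((Y t @^-1` A) `|` N0))).
  rewrite le_measure ?inE//; first exact: measurableU.
  rewrite -bigcup_mkord => w [n _ [Aw [_ tw]]].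
  have [w0|w0] := pselect (N0 w); [by right|left].
  have := contra_not (@YN0 w) w0 => /= /contrapT /(_ n t tw) Yw.
  by rewrite /preimage/= Yw.
by rewrite (le_trans (measureU2 _ _ _))// [X in (_ + X)%E]PN0 adde0.
Qed.

Variable lam : R.
Hypothesis blam : forall y, 3 * b y <= lam.

(** The lower bounds for A and for its complement add up to 1 by non-explosion, so
    both are attained; this also settles the values of Y after an explosion. *)
Lemma law_transition A t : 0 <= t ->
  P (Y t @^-1` A) = (transition b d \1_A x t)%:E.
Proof.
move=> t0; have u01 B : unit_valued (\1_B : nat -> R).
  by move=> y; rewrite indicE; case: (y \in B); rewrite ?lexx ?ler01.
have lower B : ((transition b d \1_B x t)%:E <= P (Y t @^-1` B))%E.
  have fB : P (Y t @^-1` B) \is a fin_num by apply: fin_num_measure; exact: measurable_funPTI.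
  rewrite -(fineK fB) lee_fin.
  apply: (@cvgn_to_le _ _ _ _ 0 (@cvg_partial_exp _ b d lam b0 d0 d00 blam _ x _ (u01 B) t0)).
  by move=> N _; rewrite -lee_fin fineK//; exact: partial_exp_le_law.
apply/eqP; rewrite eq_le lower andbT.
have := lower (~` A).
have -> : \1_(~` A) = (fun y => 1 - \1_A y) :> (nat -> R).
  apply/funext => y; rewrite !indicE in_setC.
  by case: (y \in A); rewrite ?subrr ?subr0.
rewrite (@transitionC _ b d lam)// preimage_setC probability_setC; last first.
  exact: measurable_funPTI.
have fA : P (Y t @^-1` A) \is a fin_num by apply: fin_num_measure; exact: measurable_funPTI.
by rewrite -(fineK fA) -EFinB !lee_fin; lra.
Qed.

End JumpChain.

(** * Rates of the locally-balanced process and uniform ergodicity *)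

(** Compare with the term of degree N in the exponential series, where N is such
    that eta * N >= 5. *)
Lemma quartic_le_expR_powR (R : realType) (c eta : R) : 0 < c -> 0 < eta ->
  exists m : nat, forall z : nat, (m <= z)%N ->
    z.+2%:R ^+ 4 <= 2^-1 * expR (c * z%:R `^ eta).
Proof.
move=> c0 eta0; pose n := Num.truncn (5 / eta).
have nE : 5 <= eta * n.+1%:R.
  by rewrite mulrC -ler_pdivrMr// ltW// truncnS_gt.
pose C := c ^+ n.+1 / n.+1`!%:R.
have C0 : 0 < C by rewrite divr_gt0 ?exprn_gt0// ltr0n fact_gt0.
(* 162 = 2 * 3 ^ 4, from z + 2 <= 3 * z and the factor 2^-1. *)
exists (Num.truncn (162 / C)).+1 => z mz.
have zC : 162 <= C * z%:R.
  rewrite mulrC -ler_pdivrMr// ltW// (lt_le_trans (truncnS_gt _))// ler_nat.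
  by [].
have z1 : 1 <= z%:R :> R by rewrite ler1n (leq_trans _ mz).
have h : C * z%:R ^+ 5 <= expR (c * z%:R `^ eta).
  have u0 : 0 <= c * z%:R `^ eta by rewrite mulr_ge0 ?powR_ge0// ltW.
  apply: (@le_trans _ _ ((c * z%:R `^ eta) ^+ n.+1 / n.+1`!%:R)); last first.
    by apply: le_trans (expR_ge1Dxn n u0); rewrite lerDr.
  rewrite exprMn /C mulrAC ler_wpM2r ?invr_ge0// ler_wpM2l ?exprn_ge0 ?(ltW c0)//.
  rewrite -[(_ `^ _) ^+ _]powR_mulrn ?powR_ge0// -powRrM -[z%:R ^+ 5]powR_mulrn ?ler0n//.
  exact: ler_powR.
rewrite ler_pdivlMl//; apply: le_trans h.
have -> : z.+2%:R = z%:R + 2 :> R by rewrite -!natr1; ring.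
move: z1 zC; move: z%:R => s s1 sC.
apply: (@le_trans _ _ (162 * s ^+ 4)); last first.
  by rewrite [s ^+ 5]exprS mulrA ler_wpM2r// exprn_ge0//; lra.
have -> : 162 * s ^+ 4 = 2 * (3 * s) ^+ 4 by ring.
by rewrite ler_wpM2l// lerXn2r ?nnegrE//; lra.
Qed.

Section Mass.
Context {R : realType}.
Variable pi : probability nat R.

Lemma mass_ge0 n : 0 <= mass pi n.
Proof. exact: fine_ge0. Qed.

Lemma probability_mass (A : set nat) L :
  pi (A `&` `I_L) = (\sum_(y < L) mass pi y * \1_A y)%:E.
Proof.
elim: L => [|L ih].
  rewrite big_ord0 (_ : _ `&` _ = set0) ?measure0//.
  by apply/seteqP; split => // y [].
have -> : A `&` `I_L.+1 = (A `&` `I_L) `|` (A `&` [set L]).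
  apply/seteqP; split => y /=.
    by move=> [Ay]; rewrite ltnS leq_eqVlt => /orP[/eqP yL|yL]; [right|left].
  by move=> [[Ay yL]|[Ay yL]]; split => //; [exact: ltnW|rewrite yL].
rewrite measureU//; last first.
  by apply/seteqP; split => // y [[_ /= yL] [_ /= y_L]]; rewrite y_L ltnn in yL.
rewrite [X in (X + _)%E]ih big_ord_recr/= EFinD; congr (_ + _)%E.
rewrite indicE; have [LA|LA] := boolP (L \in A).
  rewrite mulr1 (_ : A `&` [set L] = [set L]); last first.
    by apply/seteqP; split => y /=; [case|move=> ->; split => //; exact: set_mem].
  by rewrite /mass fineK// fin_num_measure.
rewrite mulr0 (_ : A `&` [set L] = set0) ?measure0//.
by apply/seteqP; split => // y [/= Ay yL]; move: LA; rewrite -yL mem_set.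
Qed.

Lemma sum_mass_le1 L : \sum_(y < L) mass pi y <= 1.
Proof.
have := probability_mass setT L.
under eq_bigr do rewrite indicT mulr1.
by rewrite -lee_fin => <-; exact: probability_le1.
Qed.

Lemma probability_le_mass (A : set nat) (M : R) :
  (forall L, \sum_(y < L) mass pi y * \1_A y <= M) -> fine (pi A) <= M.
Proof.
move=> h; have AE : A = \bigcup_L (A `&` `I_L).
  rewrite -setI_bigcupr (_ : \bigcup_L `I_L = setT) ?setIT//.
  by apply/seteqP; split => // y _; exists y.+1 => //=.
have cv : pi \o (fun L => A `&` `I_L) @ \oo --> pi A.
  rewrite {2}AE; apply: nondecreasing_cvg_mu => //.
  apply/nondecreasing_seqP => L; apply/subsetPset => y /= [Ay yL].
  by split => //; exact: leqW.
have fA : pi A \is a fin_num by exact: fin_num_measure.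
rewrite -lee_fin fineK//.
apply: (cvge_to_le cv); apply: nearW => L /=.
by rewrite probability_mass lee_fin.
Qed.

End Mass.

Section LocallyBalanced.
Context {R : realType}.
Variables (pi : probability nat R) (g : R -> R).
Hypotheses (g_balancing : balancing_function g)
  (g_nondecreasing : {in `[0, +oo[ &, {homo g : s t / s <= t}})
  (pi_gt0 : forall n : nat, 0 < mass pi n).

Definition birth_rate n : R := 2^-1 * g (mass pi n.+1 / mass pi n).

Definition death_rate n : R :=
  if n is m.+1 then 2^-1 * g (mass pi m / mass pi m.+1) else 0.

Local Notation b := birth_rate.
Local Notation d := death_rate.
Local Notation J := (lb_rate g (@nn_kernel R) pi).

Let ratio_gt0 m n : 0 < mass pi m / mass pi n.
Proof. by rewrite divr_gt0. Qed.

Let g_gt0 s : 0 < s -> 0 < g s.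
Proof. by case: g_balancing => _ _ + _; apply. Qed.

Lemma birth_rate_gt0 n : 0 < b n.
Proof. by rewrite mulr_gt0// g_gt0. Qed.

Lemma death_rateS_gt0 n : 0 < d n.+1.
Proof. by rewrite mulr_gt0// g_gt0. Qed.

Lemma death_rate_ge0 n : 0 <= d n.
Proof. by case: n => // n; exact/ltW/death_rateS_gt0. Qed.

(** The identity g s = s * g s^-1 at s = pi (n + 1) / pi n. *)
Lemma detailed_balance n : mass pi n * b n = mass pi n.+1 * d n.+1.
Proof.
case: g_balancing => _ _ _ gE; rewrite /b /d (gE (mass pi n.+1 / _))// invf_div.
by field; rewrite gt_eqF.
Qed.

Lemma lb_rateE x y : J x y = b x * (y == x.+1)%:R + d x * (y.+1 == x)%:R.
Proof.
rewrite /lb_rate /nn_kernel /birth_rate /death_rate; case: x => [|x].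
  by rewrite mul0r addr0 add0r; case: eqP => [->|_]; rewrite ?mulr1 ?mulr0// mulrC.
rewrite eqSS; have [->|yx] := eqVneq y x.
  by rewrite ltn_eqF// mulr0 mulr1 add0r addr0 mulr1 mulrC.
by rewrite add0r mulr0 addr0; case: eqP => [->|_]; rewrite ?mulr1 ?mulr0// mulrC.
Qed.

Lemma lb_rate_ge0 x y : 0 <= J x y.
Proof.
rewrite lb_rateE addr_ge0// mulr_ge0//; first exact/ltW/birth_rate_gt0.
exact: death_rate_ge0.
Qed.

Lemma lb_rate_birth x : J x x.+1 = b x.
Proof.
by rewrite lb_rateE eqxx gtn_eqF// ?mulr1 ?mulr0 ?addr0.
Qed.

Lemma lb_rate_death x : J x.+1 x = d x.+1.
Proof.
by rewrite lb_rateE eqxx ltn_eqF// ?mulr1 ?mulr0 ?add0r.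
Qed.

Lemma exit_rateE x : exit_rate J x = b x + d x.
Proof.
have ind a n : \sum_(k < n) (k == a :> nat)%:R = (a < n)%N%:R :> R.
  elim: n => [|n ih]; first by rewrite big_ord0.
  rewrite big_ord_recr/= ih ltnS [(a <= n)%N in RHS]leq_eqVlt [n == a]eq_sym.
  by case: eqVneq => [->|_]; rewrite ?ltnn ?add0r ?addr0.
apply: lim_near_cst => //; exists x.+2 => // n /= xn.
rewrite /series/= big_mkord; under eq_bigr do rewrite lb_rateE.
rewrite big_split/= -!mulr_sumr ind xn mulr1; congr (_ + _).
case: x xn => [|x] xn; first by rewrite mul0r.
under eq_bigr do rewrite eqSS.
by rewrite ind (ltn_trans _ xn) ?mulr1// -[x.+1]addn0 -addSnnS ltn_addr.
Qed.

Lemma exit_rate_gt0 x : 0 < b x + d x.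
Proof. by rewrite ltr_pwDl ?birth_rate_gt0 ?death_rate_ge0. Qed.

Variables (atilde a beta k : R).
Hypotheses (atilde_gt0 : 0 < atilde) (a_gt0 : 0 < a) (beta_gt1 : 1 < beta)
  (g_lower : forall s : R, 1 <= s -> s `^ atilde <= g s)
  (pi_tail : forall n : nat, k <= n%:R ->
     expR (a * beta * n%:R `^ (beta - 1)) <= mass pi n / mass pi n.+1).

Let ratio_ge1 n : k <= n%:R -> 1 <= mass pi n / mass pi n.+1.
Proof.
move=> kn; apply: le_trans (pi_tail kn); rewrite -expR0 ler_expR.
by rewrite !mulr_ge0 ?powR_ge0 ?(ltW a_gt0)// (le_trans ler01)// ltW.
Qed.

Lemma birth_rate_tail n : k <= n%:R -> b n <= 1.
Proof.
move=> kn; have [g1 _ _ _] := g_balancing.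
have : g (mass pi n.+1 / mass pi n) <= g 1.
  apply: g_nondecreasing; rewrite ?in_itv/= ?ler01 ?(ltW (ratio_gt0 _ _))//.
  by rewrite -invf_div invf_le1 ?ratio_ge1.
by rewrite g1 /b; lra.
Qed.

Lemma birth_rate_bounded : exists B, forall n, b n <= B.
Proof.
pose n0 := (Num.truncn k).+1.
exists (1 + \sum_(n < n0) b n) => n.
have b_ge0 i : 0 <= b i by exact/ltW/birth_rate_gt0.
have [nn0|n0n] := ltnP n n0.
  rewrite (bigD1 (Ordinal nn0))//= addrCA lerDl addr_ge0//.
  by apply: sumr_ge0 => i _.
apply: (le_trans (birth_rate_tail _)); last by rewrite lerDl sumr_ge0.
by rewrite ltW// (lt_le_trans (truncnS_gt _))// ler_nat.
Qed.

(** The quartic growth is what [descent_weightS] consumes. *)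
Lemma rates_tail : exists m, forall y, (m <= y)%N ->
  b y <= 1 /\ y.+1%:R ^+ 4 <= d y.
Proof.
have beta0 : 0 < beta by rewrite (lt_trans ltr01).
have c0 : 0 < a * beta * atilde by rewrite !mulr_gt0.
have eta0 : 0 < beta - 1 by rewrite subr_gt0.
have [m hm] := quartic_le_expR_powR c0 eta0.
exists (maxn m (Num.truncn k).+1).+1 => -[//|y]; rewrite ltnS geq_max => /andP[my ky].
have kn : k <= y%:R by rewrite ltW// (lt_le_trans (truncnS_gt _))// ler_nat.
split; first by apply: birth_rate_tail; rewrite (le_trans kn)// ler_nat.
apply: le_trans (hm y my) _; rewrite /d ler_wpM2l//.
rewrite mulrAC expRM; apply: le_trans (g_lower (ratio_ge1 kn)).
apply: ge0_ler_powR; rewrite ?nnegrE ?expR_ge0 ?(ltW atilde_gt0)//.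
  exact: ltW.
exact: pi_tail.
Qed.

Variables (disp : measure_display) (T : measurableType disp)
  (P : nat -> probability T R) (Y : R -> {mfun T >-> nat}).
Hypothesis Y_lbmjp : forall x : nat, markov_jump_process J x (P x) Y.

Lemma lb_uniformly_ergodic : uniformly_ergodic P Y pi.
Proof.
have [B bB] := birth_rate_bounded.
have b_ge0 x : 0 <= b x by exact/ltW/birth_rate_gt0.
have lamE x : 3 * b x <= 3 * B by rewrite ler_wpM2l.
have d00 : d 0 = 0 by [].
have law x A t : 0 <= t -> P x (Y t @^-1` A) = (transition b d \1_A x t)%:E.
  move=> t0; have [Z [H [chain jumps]]] := Y_lbmjp x.
  exact: (law_transition lb_rate_birth lb_rate_death d00 b_ge0 death_rate_ge0
    exit_rateE exit_rate_gt0 lb_rate_ge0 chain jumps lamE).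
have [m tail] := rates_tail.
have [delta0 delta00 hdelta0] :=
  descent_weight_bounded b_ge0 death_rate_ge0 death_rateS_gt0 tail.
(* The cap keeps rho positive. *)
pose delta := Num.min delta0 2^-1.
have delta_gt0 : 0 < delta by rewrite lt_min delta00 invr_gt0 ltr0n.
have delta_le : delta <= 2^-1 by rewrite ge_min lexx orbT.
have delta_lt1 : delta < 1 by apply: le_lt_trans delta_le _; rewrite invf_lt1 ?ltr1n.
have minor x h : (forall y, 0 <= h y) -> delta * h 0 <= jump_exp b d x h x 1.
  move=> h0; apply: le_trans (jump_exp_minor b_ge0 death_rate_ge0 death_rateS_gt0 h0 _).
    by rewrite ler_wpM2r// (le_trans _ (hdelta0 x))// ge_min lexx.
  by rewrite lexx andbT gerBl invr_ge0.
pose rho := 1 - delta.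
have rho0 : 0 < rho by rewrite subr_gt0.
have rho1 : rho < 1 by rewrite gtrBl.
(* The constant rho^-1 pays for rounding t down to an integer. *)
exists rho^-1, rho; split => //; first by rewrite invr_gt0.
move=> x t _ t0; apply: ge_ereal_sup => _ [A _ <-].
pose n := Num.truncn t.
have /andP[nt tn] := truncn_itv t0.
have r0 : 0 <= t - n%:R by rewrite subr_ge0.
have u01 A' : unit_valued (\1_A' : nat -> R).
  by move=> y; rewrite indicE; case: (y \in A'); rewrite ?lexx ?ler01.
have [lo [hi [lo0 hi1 hilo hU]]] := transition_contraction b_ge0 death_rate_ge0 d00
  lamE (ltW delta_gt0) (ltW delta_lt1) minor n (u01 A) r0.
have {}hU y : lo <= transition b d \1_A y t <= hi.
  by have := hU y; rewrite addrC subrK.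
have bound (A' : set nat) M : (forall y, transition b d \1_A' y t <= M) ->
    fine (pi A') <= M.
  move=> h; apply: probability_le_mass.
  exact: (stationary_le b_ge0 death_rate_ge0 d00 lamE (mass_ge0 pi)
    detailed_balance (sum_mass_le1 pi) (u01 A') t0 h).
have pihi : fine (pi A) <= hi by apply: bound => y; have /andP[] := hU y.
have fA : pi A \is a fin_num by exact: fin_num_measure.
have pilo : lo <= fine (pi A).
  have : fine (pi (~` A)) <= 1 - lo.
    apply: bound => y.
    have -> : \1_(~` A) = (fun y => 1 - \1_A y) :> (nat -> R).
      apply/funext => z; rewrite !indicE in_setC.
      by case: (z \in A); rewrite ?subrr ?subr0.
    rewrite (transitionC b_ge0 death_rate_ge0 d00 lamE)// lerB//.
    by have /andP[] := hU y.
  by rewrite probability_setC// -(fineK fA) -EFinB/=; lra.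
rewrite -[X in (X - _)%E]/(P x (Y t @^-1` A)) law// -(fineK fA) -EFinB abse_EFin lee_fin.
apply: (@le_trans _ _ (hi - lo)).
  by have /andP[? ?] := hU x; rewrite ler_norml; apply/andP; split; lra.
apply: (le_trans hilo); rewrite -/rho.
rewrite -ler_pdivrMl ?invr_gt0// invrK -exprS -powR_mulrn ?(ltW rho0)//.
by apply: ger_powR; rewrite ?rho0 ?ltW.
Qed.

End LocallyBalanced.

Theorem theorem3p1 (R : realType) (pi : probability nat R) (g : R -> R)
  (g_balancing : balancing_function g)
  (g_nondecreasing : {in `[0, +oo[ &, {homo g : s t / s <= t}})
  (g_continuous : {within `[0, +oo[, continuous g})
  (atilde a beta k : R)
  (atilde_gt0 : 0 < atilde) (a_gt0 : 0 < a) (beta_gt1 : 1 < beta)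
  (k_gt0 : 0 < k)
  (g_lower : forall s : R, 1 <= s -> s `^ atilde <= g s)
  (pi_gt0 : forall n : nat, 0 < mass pi n)
  (pi_tail : forall n : nat, k <= n%:R ->
     expR (a * beta * n%:R `^ (beta - 1)) <= mass pi n / mass pi n.+1)
  (d : measure_display) (T : measurableType d)
  (P : nat -> probability T R) (Y : R -> {mfun T >-> nat})
  (Y_lbmjp : forall x : nat,
     markov_jump_process (lb_rate g (@nn_kernel R) pi) x (P x) Y) :
  uniformly_ergodic P Y pi.
Proof.
exact: (lb_uniformly_ergodic g_balancing g_nondecreasing pi_gt0 atilde_gt0 a_gt0
  beta_gt1 g_lower pi_tail Y_lbmjp).
Qed.
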